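(* Let $n\ge 0$ be an integer, let $X$ and $X'$ be homotopy equivalent spaces, and let $i\colon A\to X$ and $j\colon B\to X'$ be $n$-skeleta of $X$ and $X'$ respectively. Then $\mathrm{cat}(i)=\mathrm{cat}(j)$. That is, for fixed $n$ the number $\mathrm{cat}_X(X_n)$ depends only on the homotopy type of $X$, and not on the choice of $n$-skeleton $X_n\to X$.
   Context: All spaces and maps are pointed. For a map $f\colon X\to Y$, $\mathrm{cat}(f)$ is the least integer $k\ge 0$ such that $X$ has an open cover $X=X_0\cup X_1\cup\cdots\cup X_k$ with each restriction $f|_{X_i}$ homotopic to a constant map ($\mathrm{cat}(f)=\infty$ if there is no such $k$). An $n$-skeleton of a space $X$ is a map $i\colon X_n\to X$ such that $X_n$ is a CW complex which is $n$-dimensional up to homotopy (homotopy equivalent to a CW complex of dimension $\le n$) and $i$ is an $n$-equivalence (isomorphism on $\pi_m$ for $m<n$, surjection on $\pi_n$). When $i\colon X_n\to X$ is an $n$-skeleton, one writes $\mathrm{cat}_X(X_n)=\mathrm{cat}(i)$. *)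

(* Defs.v *)
From mathcomp Require Import all_boot all_order all_algebra.
From mathcomp Require Import all_classical all_reals all_analysis.

Set Implicit Arguments.
Unset Strict Implicit.
Unset Printing Implicit Defensive.

Import Order.TTheory GRing.Theory Num.Theory numFieldNormedType.Exports.

Local Open Scope classical_set_scope.
Local Open Scope ring_scope.

(* Homotopies are parametrized by the unit interval of R; the maps f and g
   matter only through their restrictions to D, and the homotopy is stationary
   on S. *)
Definition homotopic_rel (R : realType) (X Y : topologicalType)
    (D S : set X) (f g : X -> Y) : Prop :=
  exists H : X * R -> Y,
    [/\ {within D `*` `[0, 1], continuous H},
        forall x, D x -> H (x, 0) = f x,
        forall x, D x -> H (x, 1) = g x &
        forall x t, S x -> t \in `[0, 1] -> H (x, t) = f x].

Definition homotopic_on (R : realType) (X Y : topologicalType)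
    (D : set X) (f g : X -> Y) : Prop :=
  homotopic_rel R D set0 f g.

Definition homotopic (R : realType) (X Y : topologicalType) (f g : X -> Y) :
    Prop :=
  homotopic_on R [set: X] f g.

Definition homotopy_equivalent (R : realType) (X Y : topologicalType) : Prop :=
  exists (f : X -> Y) (g : Y -> X),
    [/\ continuous f, continuous g,
        homotopic R (g \o f) idfun & homotopic R (f \o g) idfun].

(* X has an open cover by k + 1 sets, U 0, ..., U k, on each of which f is
   homotopic to a constant map. *)
Definition categorical_cover (R : realType) (X Y : topologicalType)
    (f : X -> Y) (k : nat) : Prop :=
  exists U : 'I_k.+1 -> set X,
    [/\ forall l, open (U l), \bigcup_l U l = [set: X] &
        forall l, exists c : Y, homotopic_on R (U l) f (cst c)].

(* None stands for infinity. *)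
Definition LS_cat (R : realType) (X Y : topologicalType) (f : X -> Y) :
    option nat :=
  if pselect (exists k, `[< categorical_cover R f k >]) is left ex
  then Some (ex_minn ex) else None.

Definition cube (R : realType) (m : nat) : set 'rV[R]_m :=
  [set v | forall l, v 0 l \in `[0, 1]].
Arguments cube R m : clear implicits.

Definition cube_boundary (R : realType) (m : nat) : set 'rV[R]_m :=
  [set v | cube R m v /\ exists l, v 0 l = 0 \/ v 0 l = 1].
Arguments cube_boundary R m : clear implicits.

(* Maps of pairs (I^m, bd I^m) -> (X, x); their values outside I^m are
   irrelevant. *)
Definition spheroid (R : realType) (X : topologicalType) (m : nat) (x : X) :
    set ('rV[R]_m -> X) :=
  [set a | {within cube R m, continuous a} /\
           forall v, cube_boundary R m v -> a v = x].
Arguments spheroid R {X} m x.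

Definition homotopy_class (R : realType) (X : topologicalType) (m : nat)
    (x : X) (a : 'rV[R]_m -> X) : set ('rV[R]_m -> X) :=
  [set b | spheroid R m x b /\ homotopic_rel R (cube R m) (cube_boundary R m) a b].

(* The underlying set of pi_m(X, x). For m = 0 the cube is a point with empty
   boundary, so this is the set of path components of X, whatever x is. *)
Definition homotopy_group (R : realType) (X : topologicalType) (m : nat)
    (x : X) : set (set ('rV[R]_m -> X)) :=
  [set homotopy_class x a | a in spheroid R m x].
Arguments homotopy_group R {X} m x.

(* The map f_* : pi_m(X, x) -> pi_m(Y, f x), which sends [a] to [f \o a]. *)
Definition homotopy_group_map (R : realType) (X Y : topologicalType) (m : nat)
    (f : X -> Y) (x : X) (C : set ('rV[R]_m -> X)) : set ('rV[R]_m -> Y) :=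
  \bigcup_(a in C) homotopy_class (f x) (f \o a).
Arguments homotopy_group_map R {X Y} m f x.

(* For m >= 1 the induced maps are group homomorphisms, so being an isomorphism
   means being bijective. All basepoints of X are considered, as X and Y need
   not be path connected. *)
Definition n_equivalence (R : realType) (n : nat) (X Y : topologicalType)
    (f : X -> Y) : Prop :=
  forall x : X,
    (forall m, (m < n)%N ->
       set_bij (homotopy_group R m x) (homotopy_group R m (f x))
               (homotopy_group_map R m f x)) /\
    set_surj (homotopy_group R n x) (homotopy_group R n (f x))
             (homotopy_group_map R n f x).

Definition sqnorm (R : realType) (d : nat) (v : 'rV[R]_d) : R :=
  \sum_l v 0 l ^+ 2.

Definition disc (R : realType) (d : nat) : set 'rV[R]_d :=
  [set v | sqnorm v <= 1].
Arguments disc R d : clear implicits.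

Definition open_disc (R : realType) (d : nat) : set 'rV[R]_d :=
  [set v | sqnorm v < 1].
Arguments open_disc R d : clear implicits.

Definition sphere (R : realType) (d : nat) : set 'rV[R]_d :=
  [set v | sqnorm v = 1].
Arguments sphere R d : clear implicits.

(* A CW structure given by its characteristic maps; the values of
   [char_map e] outside the closed disc are irrelevant. *)
Record CW_structure (R : realType) (X : topologicalType) := CWStructure {
  CW_hausdorff : hausdorff_space X;
  cell : nat -> Type;
  char_map : forall d, cell d -> 'rV[R]_d -> X;
  char_map_continuous : forall d (e : cell d),
    {within disc R d, continuous (char_map e)};
  char_map_inj : forall d (e : cell d),
    set_inj (open_disc R d) (char_map e);
  (* with the two previous fields: a homeomorphism from the open disc onto
     the open cell *)
  char_map_open : forall d (e : cell d) (U : set 'rV[R]_d), open U ->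
    exists2 V : set X, open V &
      char_map e @` (open_disc R d `&` U) =
      char_map e @` open_disc R d `&` V;
  cells_cover : forall x : X,
    exists d (e : cell d), (char_map e @` open_disc R d) x;
  cells_disjoint : forall d (e : cell d) d' (e' : cell d'),
    (char_map e @` open_disc R d) `&` (char_map e' @` open_disc R d') !=set0 ->
    existT cell d e = existT cell d' e';
  closure_finite : forall d (e : cell d),
    exists2 F : set {d' & cell d'}, finite_set F &
      (forall c, F c -> (projT1 c < d)%N) /\
      char_map e @` sphere R d `<=`
        \bigcup_(c in F) (char_map (projT2 c) @` open_disc R (projT1 c));
  weak_topology : forall C : set X,
    (forall d (e : cell d), closed (C `&` char_map e @` disc R d)) -> closed C
}.

Definition CW_complex (R : realType) (X : topologicalType) : Prop :=
  inhabited (CW_structure R X).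

Definition CW_complex_dim_le (R : realType) (n : nat) (X : topologicalType) :
    Prop :=
  exists W : CW_structure R X, forall d, (n < d)%N -> cell W d -> False.

(* n-dimensional up to homotopy *)
Definition homotopy_dim_le (R : realType) (n : nat) (X : topologicalType) :
    Prop :=
  exists K : topologicalType,
    CW_complex_dim_le R n K /\ homotopy_equivalent R X K.

Definition n_skeleton (R : realType) (n : nat) (A X : ptopologicalType)
    (i : A -> X) : Prop :=
  [/\ continuous i, i point = point,
      CW_complex R A, homotopy_dim_le R n A & n_equivalence R n i].

(* Main.v *)
Require Import Defs.
From mathcomp Require Import all_boot all_order all_algebra.
From mathcomp Require Import all_classical all_reals all_analysis.
From mathcomp Require Import ring lra.

(* An n-equivalence f : B -> Y has the lifting property up to homotopy for CW
   complexes K of dimension at most n: every phi : K -> Y is homotopic to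
   f o lam for some lam : K -> B. Since B is n-dimensional up to homotopy and
   i : A -> X is an n-equivalence, the composite of j : B -> X' with a homotopy
   equivalence g : X' -> X factors up to homotopy as i o lam with
   lam : B -> A; preimages under lam of a categorical cover for i then form one
   for g o j, hence for j, and the situation is symmetric in i and j.

   The lifting property is obtained cell by cell. A map of pairs from
   (disc, sphere) is pulled back to a cube along a quotient map which collapses
   all faces but one to a single point of the sphere; there, injectivity on
   pi_m provides an extension over the disc, and surjectivity on pi_(m+1)
   corrects the extension so that it becomes homotopic to the given map. *)

Set Implicit Arguments.
Unset Strict Implicit.
Unset Printing Implicit Defensive.

Import Order.TTheory GRing.Theory Num.Theory numFieldNormedType.Exports.

Local Open Scope classical_set_scope.
Local Open Scope ring_scope.

(** * Continuity on subsets and homotopies *)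

(** Two things keep the step over one cell from being a direct use of homotopy groups. On the
    boundary of the cell, [phi] and [f \o lam] agree only up to the homotopy built so far, so the
    homotopy extension property of the pair (disc, sphere) comes first and makes them agree strictly
    there. Moreover cells are round discs, while homotopy groups are made of cubes with constant
    boundary value. Under the quotient map the sphere becomes a cube of dimension [m] with its
    boundary collapsed: the boundary map becomes a spheroid [a], and the map on the disc a
    null-homotopy of [f \o a]. Injectivity yields a null-homotopy of [a], but its image under [f]
    may differ from the given one by an element of pi_(m+1) of the target. This is why surjectivity
    is used one dimension higher, which the bound m + 1 <= n on the cell dimension permits.

    The lift and its homotopy are total functions on K whose continuity is recorded only along
    characteristic maps until the end. The homotopy is not kept on lower cells but reparametrized at
    every step, which is harmless because only n + 1 steps occur. *)

Lemma within_comp (X Y Z : topologicalType) (D : set X) (E : set Y)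
    (f : X -> Y) (g : Y -> Z) :
  {within D, continuous f} -> {within E, continuous g} ->
  (forall x, D x -> E (f x)) -> {within D, continuous (fun x => g (f x))}.
Proof.
move=> /subspace_continuousP cf /subspace_continuousP cg DE.
apply/subspace_continuousP => x Dx V Vgf.
have : nbhs x [set y | D y -> E (f y) -> V (g (f y))].
  exact: cf _ Dx _ (cg _ (DE _ Dx) _ Vgf).
by apply: (@filterS _ (nbhs x)) => y /= h Dy; apply: (h Dy); exact: DE.
Qed.

Lemma within_pair (X Y Z : topologicalType) (D : set X)
    (f : X -> Y) (g : X -> Z) :
  {within D, continuous f} -> {within D, continuous g} ->
  {within D, continuous (fun x => (f x, g x))}.
Proof.
move=> /subspace_continuousP cf /subspace_continuousP cg.
apply/subspace_continuousP => x Dx.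
by apply: cvg_pair; [exact: cf | exact: cg].
Qed.

Lemma continuous_pair (X Y Z : topologicalType) (f : X -> Y) (g : X -> Z) :
  continuous f -> continuous g -> continuous (fun x => (f x, g x)).
Proof. by move=> cf cg x; apply: cvg_pair; [exact: cf | exact: cg]. Qed.

Lemma continuous_add (R : realType) (X : topologicalType) (f g : X -> R) :
  continuous f -> continuous g -> continuous (fun x => f x + g x).
Proof. by move=> cf cg x; apply: cvgD; [exact: cf | exact: cg]. Qed.

Lemma continuous_opp (R : realType) (X : topologicalType) (f : X -> R) :
  continuous f -> continuous (fun x => - f x).
Proof. by move=> cf x; apply: cvgN; exact: cf. Qed.

Lemma continuous_mul (R : realType) (X : topologicalType) (f g : X -> R) :
  continuous f -> continuous g -> continuous (fun x => f x * g x).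
Proof. by move=> cf cg x; apply: cvgM; [exact: cf | exact: cg]. Qed.

Lemma continuous_then (X Y Z : topologicalType) (f : X -> Y) (g : Y -> Z) :
  continuous f -> continuous g -> continuous (fun x => g (f x)).
Proof. by move=> cf cg x; apply: continuous_comp; [exact: cf | exact: cg]. Qed.

Lemma continuous_idfun (X : topologicalType) : continuous (fun x : X => x).
Proof. by move=> x; exact: cvg_id. Qed.

Ltac continuity_arith :=
  match goal with
  | |- continuous (fun x => x) => exact: continuous_idfun
  | |- continuous fst => by move=> ?; exact: cvg_fst
  | |- continuous snd => move=> ?; exact: cvg_snd
  | |- continuous (fun x => fst (@?f x)) =>
      apply: (@continuous_then _ _ _ f fst); continuity_arith
  | |- continuous (fun x => snd (@?f x)) =>
      apply: (@continuous_then _ _ _ f snd); continuity_arith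
  | |- continuous (fun _ => (_, _)) => apply: continuous_pair; continuity_arith
  | |- continuous (fun _ => _ + _) => apply: continuous_add; continuity_arith
  | |- continuous (fun _ => - _) => apply: continuous_opp; continuity_arith
  | |- continuous (fun _ => _ * _) => apply: continuous_mul; continuity_arith
  | |- continuous (GRing.mul _) => apply: continuous_mul; continuity_arith
  | |- continuous _ => exact: cst_continuous
  | _ => idtac
  end.

Lemma within_ext (X Y : topologicalType) (D : set X) (f g : X -> Y) :
  (forall x, D x -> f x = g x) ->
  {within D, continuous f} -> {within D, continuous g}.
Proof.
move=> fg; apply: subspace_eq_continuous => x xD; apply: fg.
by move: xD; rewrite inE.
Qed.

(** Pasting lemma for two closed pieces, presented by the sign of a real function so that the
    overlap is its zero set. At a zero, each piece controls its own side and the agreement of [f]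
    and [g] makes both approach the same value. *)
Lemma within_ite (R : realType) (X Y : topologicalType) (D : set X)
    (c : X -> R) (f g : X -> Y) :
  {within D, continuous c} ->
  {within D `&` [set x | c x <= 0], continuous f} ->
  {within D `&` [set x | 0 <= c x], continuous g} ->
  (forall x, D x -> c x = 0 -> f x = g x) ->
  {within D, continuous (fun x => if c x <= 0 then f x else g x)}.
Proof.
move=> /subspace_continuousP cc /subspace_continuousP cf.
move=> /subspace_continuousP cg fg.
apply/subspace_continuousP => x Dx V.
rewrite /from_subspace /=.
have [cx|cx|cx] := ltgtP (c x) 0 => Vx.
- have h1 := cf x (conj Dx (ltW cx)) _ Vx.
  have h2 : nbhs x [set y | D y -> c y < 0] by exact: cc x Dx _ (lt_nbhsl cx).
  apply: (@filterS2 _ (nbhs x)) h1 h2 => y /= h1 h2 Dy; rewrite (ltW (h2 Dy)).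
  by apply: h1; split => //; exact: ltW (h2 Dy).
- have h1 := cg x (conj Dx (ltW cx)) _ Vx.
  have h2 : nbhs x [set y | D y -> 0 < c y] by exact: cc x Dx _ (lt_nbhsr cx).
  apply: (@filterS2 _ (nbhs x)) h1 h2 => y /= h1 h2 Dy.
  rewrite leNgt (h2 Dy); apply: h1; split => //; exact: ltW (h2 Dy).
- have cx0 : c x <= 0 by rewrite cx.
  have cx1 : 0 <= c x by rewrite cx.
  have h1 : nbhs x [set y | D y /\ c y <= 0 -> V (f y)].
    exact: cf x (conj Dx cx0) _ Vx.
  rewrite (fg x Dx cx) in Vx.
  have h2 : nbhs x [set y | D y /\ 0 <= c y -> V (g y)].
    exact: cg x (conj Dx cx1) _ Vx.
  apply: (@filterS2 _ (nbhs x)) h1 h2 => y /= h1 h2 Dy.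
  case: ifP => cy; first by apply: h1.
  by apply: h2; split => //; rewrite leNgt; apply/negP => /ltW; rewrite cy.
Qed.

Lemma homotopic_rel_refl (R : realType) (X Y : topologicalType) (D S : set X)
    (f : X -> Y) :
  {within D, continuous f} -> homotopic_rel R D S f f.
Proof.
move=> cf; exists (fun p => f p.1); split => //.
apply: (within_comp _ cf); last by move=> -[x t] [].
by apply: continuous_subspaceT => x; exact: cvg_fst.
Qed.

Lemma homotopic_rel_ext (R : realType) (X Y : topologicalType) (D S : set X)
    (f f' g g' : X -> Y) : S `<=` D ->
  (forall x, D x -> f x = f' x) -> (forall x, D x -> g x = g' x) ->
  homotopic_rel R D S f g -> homotopic_rel R D S f' g'.
Proof.
move=> SD ff gg [H [cH H0 H1 HS]]; exists H; split => //.
- by move=> x Dx; rewrite H0 ?ff.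
- by move=> x Dx; rewrite H1 ?gg.
- by move=> x t Sx It; rewrite HS ?ff //; exact: SD.
Qed.

Lemma homotopic_rel_sym (R : realType) (X Y : topologicalType) (D S : set X)
    (f g : X -> Y) : S `<=` D ->
  homotopic_rel R D S f g -> homotopic_rel R D S g f.
Proof.
move=> SD [H [cH H0 H1 HS]].
have I1 (t : R) : (t \in `[0, 1]) -> (1 - t \in `[0, 1]).
  by rewrite !in_itv /= => /andP[? ?]; apply/andP; split; lra.
exists (fun p => H (p.1, 1 - p.2)); split => /=.
- apply: (within_comp (f := fun p : X * R => (p.1, 1 - p.2)) _ cH).
    by apply: continuous_subspaceT; continuity_arith.
  by move=> [x t] [/= Dx It]; split => //; exact: I1.
- by move=> x Dx; rewrite subr0 H1.
- by move=> x Dx; rewrite subrr H0.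
- move=> x t Sx It; rewrite HS ?I1 // -(HS x 1) //.
    by rewrite H1 //; exact: SD.
  by rewrite in_itv /= ler01 lexx.
Qed.

Lemma within_concat (R : realType) (X Y : topologicalType) (D : set X)
    (H G : X * R -> Y) :
  {within D `*` `[0, 1], continuous H} ->
  {within D `*` `[0, 1], continuous G} ->
  (forall x, D x -> H (x, 1) = G (x, 0)) ->
  {within D `*` `[0, 1], continuous (fun p =>
     if 2 * p.2 - 1 <= 0 then H (p.1, 2 * p.2) else G (p.1, 2 * p.2 - 1))}.
Proof.
move=> cH cG HG; apply: within_ite.
- by apply: continuous_subspaceT; continuity_arith.
- apply: (within_comp (f := fun p : X * R => (p.1, 2 * p.2)) _ cH).
    by apply: continuous_subspaceT; continuity_arith.
  move=> [x t] /= [[/= Dx]]; rewrite in_itv /= => /andP[? ?] ?.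
  by split => //=; rewrite in_itv /=; apply/andP; split; lra.
- apply: (within_comp (f := fun p : X * R => (p.1, 2 * p.2 - 1)) _ cG).
    by apply: continuous_subspaceT; continuity_arith.
  move=> [x t] /= [[/= Dx]]; rewrite in_itv /= => /andP[? ?] ?.
  by split => //=; rewrite in_itv /=; apply/andP; split; lra.
- move=> [x t] /= [Dx _] t2; rewrite t2 (_ : 2 * t = 1) ?HG //; lra.
Qed.

Lemma homotopic_rel_trans (R : realType) (X Y : topologicalType) (D S : set X)
    (f g h : X -> Y) : S `<=` D ->
  homotopic_rel R D S f g -> homotopic_rel R D S g h ->
  homotopic_rel R D S f h.
Proof.
move=> SD [H [cH H0 H1 HS]] [G [cG G0 G1 GS]].
exists (fun p => if 2 * p.2 - 1 <= 0 then H (p.1, 2 * p.2)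
                 else G (p.1, 2 * p.2 - 1)); split => /=.
- by apply: within_concat => // x Dx; rewrite H1 ?G0.
- by move=> x Dx; rewrite ifT ?mulr0 ?H0 //; lra.
- move=> x Dx; rewrite ifF; last by apply/negbTE; rewrite -ltNge; lra.
  by rewrite (_ : 2 * 1 - 1 = 1) ?G1 //; ring.
- move=> x t Sx; rewrite in_itv /= => /andP[t0 t1]; case: lerP => t2.
    by rewrite HS // in_itv /=; apply/andP; split; lra.
  have I1 : (1 : R) \in `[0, 1] by rewrite in_itv /= ler01 lexx.
  rewrite GS //; last by rewrite in_itv /=; apply/andP; split; lra.
  by rewrite -(H1 _ (SD _ Sx)) HS.
Qed.

Lemma homotopic_rel_postcomp (R : realType) (X Y Z : topologicalType)
    (D S : set X) (f g : X -> Y) (h : Y -> Z) : continuous h ->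
  homotopic_rel R D S f g -> homotopic_rel R D S (h \o f) (h \o g).
Proof.
move=> ch [H [cH H0 H1 HS]]; exists (h \o H); split => /=.
- apply: (within_comp (E := setT) cH) => //; exact: continuous_subspaceT.
- by move=> x Dx; rewrite H0.
- by move=> x Dx; rewrite H1.
- by move=> x t Sx It; rewrite HS.
Qed.

Lemma homotopic_rel_precomp (R : realType) (X Y Z : topologicalType)
    (D S : set X) (D' S' : set Z) (f g : X -> Y) (h : Z -> X) :
  {within D', continuous h} -> (forall z, D' z -> D (h z)) ->
  (forall z, S' z -> S (h z)) ->
  homotopic_rel R D S f g -> homotopic_rel R D' S' (f \o h) (g \o h).
Proof.
move=> ch DD SS [H [cH H0 H1 HS]]; exists (fun p => H (h p.1, p.2)); split => /=.
- apply: (within_comp (f := fun p : Z * R => (h p.1, p.2)) _ cH).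
    apply: within_pair; last by apply: continuous_subspaceT => x; exact: cvg_snd.
    apply: (within_comp _ ch); last by move=> [z t] [].
    by apply: continuous_subspaceT => x; exact: cvg_fst.
  by move=> [z t] [/= Dz It]; split => //; exact: DD.
- by move=> z Dz; rewrite H0 //; exact: DD.
- by move=> z Dz; rewrite H1 //; exact: DD.
- by move=> z t Sz It; rewrite HS //; exact: SS.
Qed.

(** * Gluing along compact sets *)

(** The set under [q] is relatively closed in a compact set, hence compact, so its image is compact
    in a Hausdorff space. All later gluing uses this: it shows that preimages of closed sets are
    closed when a map is known only after composition with [q]. *)
Lemma closed_image_preimage (X Y Z : topologicalType) (C : set X)
    (q : X -> Y) (F : X -> Z) (V : set Z) :
  hausdorff_space Y -> compact C -> {within C, continuous q} ->
  {within C, continuous F} -> closed V ->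
  closed (q @` (C `&` F @^-1` V)).
Proof.
move=> hY cC cq cF clV; apply: compact_closed => //.
have /closed_subspaceP[V' clV' V'E] :
    closed (F @^-1` V : set (subspace C)).
  by move/continuous_closedP: cF; apply.
apply: continuous_compact.
  by apply: continuous_subspaceW cq; exact: subIsetl.
by rewrite setIC -V'E setIC; exact: compact_closedI.
Qed.

(** The preimage of a closed set is, within the union, a finite union of images of the closed kind
    above. Finiteness of [F] is what lets the boundary of a cell be handled through
    closure-finiteness. *)
Lemma within_finite_cover (I : Type) (F : set I) (T : I -> topologicalType)
    (C : forall i, set (T i)) (Y Z : topologicalType) (q : forall i, T i -> Y)
    (g : Y -> Z) :
  finite_set F -> hausdorff_space Y -> (forall i, F i -> compact (C i)) ->
  (forall i, F i -> {within C i, continuous (q i)}) ->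
  (forall i, F i -> {within C i, continuous (fun v => g (q i v))}) ->
  {within \bigcup_(i in F) (q i @` C i), continuous g}.
Proof.
move=> finF hY cC cq cg; apply/continuous_closedP => V clV.
apply/closed_subspaceP.
exists (\bigcup_(i in F) (q i @` (C i `&` (fun v => g (q i v)) @^-1` V))).
  apply: (@closed_bigcup _ {classic I}) => // i Fi.
  by apply: closed_image_preimage; [| exact: cC | exact: cq | exact: cg |].
apply/seteqP; split=> y /=.
  by move=> [[i Fi [v [Cv gv] <-]] yD]; split.
move=> [gy [i Fi [v Cv qv]]]; split; last by exists i => //; exists v.
by exists i => //; exists v => //; split => //=; rewrite qv.
Qed.

Lemma within_image (X Y Z : topologicalType) (C : set X) (q : X -> Y)
    (g : Y -> Z) :
  hausdorff_space Y -> compact C -> {within C, continuous q} ->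
  {within C, continuous (fun v => g (q v))} ->
  {within q @` C, continuous g}.
Proof.
move=> hY cC cq cg.
have -> : q @` C = \bigcup_(i in [set: unit]) q @` C.
  by apply/seteqP; split => y; [exists tt | case].
exact: (@within_finite_cover unit _ (fun=> X) (fun=> C) Y Z (fun=> q)).
Qed.

Lemma hausdorff_prod (X Y : topologicalType) :
  hausdorff_space X -> hausdorff_space Y -> hausdorff_space (X * Y)%type.
Proof.
move=> hX hY [x y] [x' y'] cl; congr pair.
- apply: hX => A B nA nB.
  have [||z [zA zB]] := cl (A `*` setT) (B `*` setT).
  + by exists (A, setT) => //; split => //; exact: filterT.
  + by exists (B, setT) => //; split => //; exact: filterT.
  by exists z.1; split; [case: zA | case: zB].
- apply: hY => A B nA nB.
  have [||z [zA zB]] := cl (setT `*` A) (setT `*` B).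
  + by exists (setT, A) => //; split => //; exact: filterT.
  + by exists (setT, B) => //; split => //; exact: filterT.
  by exists z.2; split; [case: zA | case: zB].
Qed.

(** * Homotopy groups *)

Lemma cube_boundary_sub (R : realType) (m : nat) :
  cube_boundary R m `<=` cube R m.
Proof. by move=> v []. Qed.

Lemma homotopy_class_self (R : realType) (X : topologicalType) (m : nat)
    (x : X) (a : 'rV[R]_m -> X) : spheroid R m x a -> homotopy_class x a a.
Proof. by move=> sa; split => //; apply: homotopic_rel_refl; case: sa. Qed.

Lemma homotopy_class_eq (R : realType) (X : topologicalType) (m : nat)
    (x : X) (a b : 'rV[R]_m -> X) :
  homotopic_rel R (cube R m) (cube_boundary R m) a b ->
  homotopy_class x a = homotopy_class x b.
Proof.
have sub := @cube_boundary_sub R m.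
move=> ab; apply/seteqP; split=> c [sc h]; split=> //.
- exact: (homotopic_rel_trans sub (homotopic_rel_sym sub ab) h).
- exact: (homotopic_rel_trans sub ab h).
Qed.

(** The classes in the union defining [homotopy_group_map] all coincide, since composing with [f]
    preserves homotopy of representatives. *)
Lemma homotopy_group_map_class (R : realType) (X Y : topologicalType) (m : nat)
    (f : X -> Y) (x : X) (a : 'rV[R]_m -> X) :
  continuous f -> spheroid R m x a ->
  homotopy_group_map R m f x (homotopy_class x a) = homotopy_class (f x) (f \o a).
Proof.
move=> cf sa; apply/seteqP; split=> b.
  move=> [c [sc ac]] cb; rewrite (homotopy_class_eq _ (b := f \o c)) //.
  exact: homotopic_rel_postcomp.
by exists a => //; exact: homotopy_class_self.
Qed.

Lemma n_equivalence_inj (R : realType) (n m : nat) (X Y : topologicalType)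
    (f : X -> Y) (x : X) (a b : 'rV[R]_m -> X) :
  continuous f -> n_equivalence R n f -> (m < n)%N ->
  spheroid R m x a -> spheroid R m x b ->
  homotopic_rel R (cube R m) (cube_boundary R m) (f \o a) (f \o b) ->
  homotopic_rel R (cube R m) (cube_boundary R m) a b.
Proof.
move=> cf /(_ x) [/(_ m) bij _] mn sa sb ab.
have [_ inj _] := bij mn.
have : homotopy_class x a = homotopy_class x b.
  apply: inj; rewrite ?inE; [by exists a | by exists b |].
  by rewrite !homotopy_group_map_class //; exact: homotopy_class_eq.
by move=> ab'; have := homotopy_class_self sb; rewrite -ab' => -[].
Qed.

Lemma n_equivalence_surj (R : realType) (n m : nat) (X Y : topologicalType)
    (f : X -> Y) (x : X) (w : 'rV[R]_m -> Y) :
  continuous f -> n_equivalence R n f -> (m <= n)%N ->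
  spheroid R m (f x) w ->
  exists2 a, spheroid R m x a &
    homotopic_rel R (cube R m) (cube_boundary R m) (f \o a) w.
Proof.
move=> cf /(_ x) [bij surj] mn sw.
have {}surj : set_surj (homotopy_group R m x) (homotopy_group R m (f x))
    (homotopy_group_map R m f x).
  move: mn; rewrite leq_eqVlt => /predU1P[-> //|mn].
  by have [] := bij _ mn.
have [|_ [a sa <-]] := surj (homotopy_class (f x) w); first by exists w.
rewrite homotopy_group_map_class // => e; exists a => //.
by have := homotopy_class_self sw; rewrite -e => -[].
Qed.

(** * Splitting off the first coordinate of a cube *)

Definition vhead (R : realType) (m : nat) (z : 'rV[R]_m.+1) : R := z 0 ord0.

Definition vtail (R : realType) (m : nat) (z : 'rV[R]_m.+1) : 'rV[R]_m :=
  \row_j z 0 (lift ord0 j).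

Definition vcons (R : realType) (m : nat) (t : R) (u : 'rV[R]_m) :
    'rV[R]_m.+1 :=
  \row_i (if unlift ord0 i is Some j then u 0 j else t).

Lemma vhead_cons (R : realType) (m : nat) (t : R) (u : 'rV[R]_m) :
  vhead (vcons t u) = t.
Proof. by rewrite /vhead mxE unlift_none. Qed.

Lemma vtail_cons (R : realType) (m : nat) (t : R) (u : 'rV[R]_m) :
  vtail (vcons t u) = u.
Proof. by apply/rowP => j; rewrite !mxE liftK. Qed.

Lemma vcons_eta (R : realType) (m : nat) (z : 'rV[R]_m.+1) :
  vcons (vhead z) (vtail z) = z.
Proof. by apply/rowP => i; rewrite mxE; case: unliftP => [j|] ->; rewrite ?mxE. Qed.

Lemma forall_ord_recl (m : nat) (P : 'I_m.+1 -> Prop) :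
  (forall i, P i) <-> P ord0 /\ forall j, P (lift ord0 j).
Proof.
split=> [h|[h0 h] i]; first by split.
by case: (unliftP ord0 i) => [j|] ->.
Qed.

Lemma cube_cons (R : realType) (m : nat) (z : 'rV[R]_m.+1) :
  cube R m.+1 z <-> (0 <= vhead z <= 1) /\ cube R m (vtail z).
Proof.
rewrite /cube /= (forall_ord_recl (fun i => z 0 i \in _)) in_itv /=.
by split=> -[? h]; split=> // j; have := h j; rewrite mxE.
Qed.

Lemma cube_boundary_cons (R : realType) (m : nat) (z : 'rV[R]_m.+1) :
  cube_boundary R m.+1 z <-> cube R m.+1 z /\
    [\/ vhead z = 0, vhead z = 1 | cube_boundary R m (vtail z)].
Proof.
split=> -[cz].
  move=> [i]; case: (unliftP ord0 i) => [j|] -> h; split=> //.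
    constructor 3; split; first by have /cube_cons[] := cz.
    by exists j; rewrite mxE.
  by case: h; [constructor 1 | constructor 2].
move=> h; split=> //; case: h => [h|h|[_ [j]]].
- by exists ord0; left.
- by exists ord0; right.
- by rewrite mxE => h; exists (lift ord0 j).
Qed.

Lemma within_rV (R : realType) (X : topologicalType) (m : nat) (D : set X)
    (f : X -> 'rV[R]_m) :
  (forall i, {within D, continuous (fun x => f x 0 i)}) ->
  {within D, continuous f}.
Proof.
move=> cf; apply/subspace_continuousP => x Dx V [P nP sPV].
have : \forall y \near within D (nbhs x), forall i, P 0 i (f y 0 i).
  apply: filter_forall => i.
  by move: (cf i) => /subspace_continuousP/(_ x Dx); apply; exact: nP.
apply: (@filterS _ (nbhs x)) => y /= h Dy; apply: sPV => i j.
by rewrite (ord1 i); exact: h.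
Qed.

Lemma continuous_rV (R : realType) (X : topologicalType) (m : nat)
    (f : X -> 'rV[R]_m) :
  (forall i, continuous (fun x => f x 0 i)) -> continuous f.
Proof.
move=> cf; apply/continuous_subspace_setT; apply: within_rV => i.
exact: continuous_subspaceT.
Qed.

Lemma continuous_vhead (R : realType) (m : nat) : continuous (@vhead R m).
Proof. exact: coord_continuous. Qed.

Lemma continuous_vtail (R : realType) (m : nat) : continuous (@vtail R m).
Proof.
apply: continuous_rV => i.
have -> : (fun z : 'rV[R]_m.+1 => vtail z 0 i) = (fun z => z 0 (lift ord0 i)).
  by apply/funext => z; rewrite mxE.
exact: coord_continuous.
Qed.

Lemma continuous_vcons (R : realType) (m : nat) :
  continuous (fun p : R * 'rV[R]_m => vcons p.1 p.2).
Proof.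
apply: continuous_rV => i; case: (unliftP ord0 i) => [j|] ->.
  have -> : (fun p : R * 'rV[R]_m => vcons p.1 p.2 0 (lift ord0 j)) =
      (fun p => p.2 0 j).
    by apply/funext => p; rewrite mxE liftK.
  apply: (continuous_then (f := snd) (g := fun M : 'rV[R]_m => M 0 j)).
    by continuity_arith.
  exact: coord_continuous.
have -> : (fun p : R * 'rV[R]_m => vcons p.1 p.2 0 ord0) = fst.
  by apply/funext => p; rewrite mxE unlift_none.
by continuity_arith.
Qed.

(** * Compression of cubes *)

(* The cube I^(m+1) is I^m x I, and P is a path of maps from f \o a to a constant
   map; Psi is a path from a to a constant map that lifts it up to homotopy. *)
Lemma compression_cube (R : realType) (n m : nat) (B Y : topologicalType)
    (f : B -> Y) (b : B) (a : 'rV[R]_m -> B) (P : 'rV[R]_m * R -> Y) :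
  continuous f -> n_equivalence R n f -> (m < n)%N -> spheroid R m b a ->
  {within cube R m `*` `[0, 1], continuous P} ->
  (forall u, cube R m u -> P (u, 0) = f (a u)) ->
  (forall u, cube R m u -> P (u, 1) = f b) ->
  (forall u t, cube_boundary R m u -> t \in `[0, 1] -> P (u, t) = f b) ->
  exists Psi : 'rV[R]_m * R -> B,
    [/\ {within cube R m `*` `[0, 1], continuous Psi},
        forall u, cube R m u -> Psi (u, 0) = a u,
        forall u, cube R m u -> Psi (u, 1) = b,
        forall u t, cube_boundary R m u -> t \in `[0, 1] -> Psi (u, t) = b &
        homotopic_rel R (cube R m `*` (`[0, 1] : set R))
          [set p | [/\ cube R m p.1, p.2 \in `[0, 1] &
                   [\/ p.2 = 0, p.2 = 1 | cube_boundary R m p.1]]]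
          P (f \o Psi)].
Proof.
move=> cf nf mn sa cP P0 P1 Pb.
have sub := @cube_boundary_sub R m.
have sb : spheroid R m b (cst b).
  by split=> //; apply: continuous_subspaceT; exact: cst_continuous.
(* [P] itself is a null-homotopy of [f \o a], so injectivity on pi_m makes [a] null-homotopic. *)
have [A [cA A0 A1 Ab]] : homotopic_rel R (cube R m) (cube_boundary R m) a (cst b).
  apply: (n_equivalence_inj cf nf mn sa sb); exists P; split=> // u t ut It.
  by rewrite Pb //= (proj2 sa).
have {}Ab u t : cube_boundary R m u -> t \in `[0, 1] -> A (u, t) = b.
  by move=> bu It; rewrite Ab // (proj2 sa).
(* The path P followed backwards by f A, so that P is a subpath of W. *)
pose W (p : 'rV[R]_m * R) := if p.2 <= 0 then f (A (p.1, - p.2)) else P p.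
have cW : {within cube R m `*` `[-1, 1], continuous W}.
  apply: within_ite.
  - by apply: continuous_subspaceT; continuity_arith.
  - apply: (within_comp (E := setT) _ (continuous_subspaceT cf)) => //.
    apply: (within_comp (f := fun p : 'rV[R]_m * R => (p.1, - p.2)) _ cA).
      by apply: continuous_subspaceT; continuity_arith.
    move=> [u t] /= [[/= cu]]; rewrite in_itv /= => /andP[? ?] ?.
    by split=> //=; rewrite in_itv /=; apply/andP; split; lra.
  - apply: continuous_subspaceW cP => -[u t] /= [[/= cu]].
    by rewrite !in_itv /= => /andP[? ?] ?; split=> //=; lra.
  - by move=> [u t] [/= cu _] ->; rewrite oppr0 P0 // A0.
have WP u t : cube R m u -> 0 <= t -> W (u, t) = P (u, t).
  move=> cu t0; rewrite /W /=; case: ifPn => // t0'.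
  by rewrite (_ : t = 0) ?oppr0 ?A0 ?P0 //; lra.
have WA u t : t <= 0 -> W (u, t) = f (A (u, - t)) by rewrite /W /= => ->.
have Wb u t : cube_boundary R m u -> -1 <= t <= 1 -> W (u, t) = f b.
  move=> bu t1; case: (leP t 0) => t0.
    by rewrite WA // Ab // in_itv /=; lra.
  by rewrite WP ?Pb //; [rewrite in_itv /=; lra | exact: sub | exact: ltW].
have W1 u : cube R m u -> W (u, 1) = f b by move=> cu; rewrite WP // P1.
have WN1 u : cube R m u -> W (u, -1) = f b.
  by move=> cu; rewrite WA ?opprK ?A1 //; lra.
(* [W] is constantly [f b] at both ends and on the sides, so after rescaling [-1, 1] to [0, 1] it is
   a spheroid of dimension m + 1. It measures how far [P] is from [f \o A]. *)
pose w (z : 'rV[R]_m.+1) := W (vtail z, 2 * vhead z - 1).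
have sw : spheroid R m.+1 (f b) w.
  split.
    apply: (within_comp (f := fun z => (vtail z, 2 * vhead z - 1)) _ cW).
      apply: continuous_subspaceT.
      apply: (continuous_pair (@continuous_vtail R m)).
      apply: continuous_add; last by exact: cst_continuous.
      apply: continuous_mul; last exact: continuous_vhead.
      exact: cst_continuous.
    move=> z /cube_cons[z1 cz]; split=> //=; rewrite in_itv /=; lra.
  move=> z /cube_boundary_cons[/cube_cons[z1 cz]].
  rewrite /w; case=> [->|->|bz].
  - by rewrite (_ : 2 * 0 - 1 = -1) ?WN1 //; ring.
  - by rewrite (_ : 2 * 1 - 1 = 1) ?W1 //; ring.
  - by rewrite Wb //; lra.
have [c sc fcw] := n_equivalence_surj cf nf mn sw.
have [H [cH H0 H1 Hb]] :=
  homotopic_rel_sym (@cube_boundary_sub R m.+1) fcw.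
have cubeE u t : cube R m u -> 0 <= t <= 1 -> cube R m.+1 (vcons t u).
  by move=> cu t01; apply/cube_cons; rewrite vhead_cons vtail_cons.
have bdE u t : cube R m u -> 0 <= t <= 1 ->
    [\/ t = 0, t = 1 | cube_boundary R m u] ->
    cube_boundary R m.+1 (vcons t u).
  move=> cu t01 h; apply/cube_boundary_cons; split; first exact: cubeE.
  by rewrite vhead_cons vtail_cons.
pose g (p : 'rV[R]_m * R) := vcons (2 * p.2 - 1) p.1.
have cg : continuous g.
  have cg1 : continuous (fun p : 'rV[R]_m * R => (2 * p.2 - 1, p.1)).
    by continuity_arith.
  exact: (continuous_then cg1 (@continuous_vcons R m)).
(* The null-homotopy [A] followed by the correction [c], read as a path of maps from [cst b] to
   itself. Its image under [f] is, up to homotopy, [A] pushed forward, then traversed backwards,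
   then [P]. *)
exists (fun p => if 2 * p.2 - 1 <= 0 then A (p.1, 2 * p.2) else c (g p)).
split.
- apply: within_ite.
  + by apply: continuous_subspaceT; continuity_arith.
  + apply: (within_comp (f := fun p : 'rV[R]_m * R => (p.1, 2 * p.2)) _ cA).
      by apply: continuous_subspaceT; continuity_arith.
    move=> [u t] /= [[/= cu]]; rewrite in_itv /= => t01 t2.
    split=> //=; rewrite in_itv /=; lra.
  + apply: (within_comp (continuous_subspaceT cg) (proj1 sc)).
    move=> [u t] /= [[/= cu]]; rewrite in_itv /= => t01 t2.
    by apply: cubeE => //=; lra.
  + move=> [u t] /= [/= cu _] t2.
    rewrite (_ : 2 * t = 1) ?A1 //; last lra.
    rewrite (proj2 sc) // /g /=; apply: bdE => //; first lra.
    by constructor 1; lra.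
- by move=> u cu /=; rewrite ifT ?mulr0 ?A0 //; lra.
- move=> u cu /=; rewrite ifF; last by apply/negbTE; rewrite -ltNge; lra.
  rewrite (proj2 sc) // /g /=; apply: bdE => //; first lra.
  by constructor 2; lra.
- move=> u t bu; rewrite in_itv /= => t01; case: ifPn => t2.
    by rewrite Ab // in_itv /=; lra.
  rewrite (proj2 sc) // /g /=; apply: bdE => //; [exact: sub| |by constructor 3].
  by rewrite -ltNge in t2; lra.
(* The path 0, -1, 1 in the parameter interval of [W]: the first half gives [f (A (u, 2 * t))], and
   4t - 3 = 2(2t - 1) - 1 makes the second half [w] at height 2t - 1. It has the same endpoints as
   the identity path, along which [W] is [P], and a linear homotopy inside [-1, 1] joins the two. *)
pose l (t : R) := if 2 * t - 1 <= 0 then - (2 * t) else 4 * t - 3.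
have l_in t : 0 <= t <= 1 -> -1 <= l t <= 1.
  by rewrite /l; case: ifPn; rewrite -?ltNge => ? ?; lra.
have cl : continuous l.
  apply/continuous_subspace_setT; apply: within_ite => /=.
  - by apply: continuous_subspaceT; continuity_arith.
  - by apply: continuous_subspaceT; continuity_arith.
  - by apply: continuous_subspaceT; continuity_arith.
  - by move=> t _ t2; lra.
set S := (X in homotopic_rel _ _ X).
have SD : S `<=` cube R m `*` `[0, 1] by move=> p [].
apply: (homotopic_rel_trans (g := fun p => W (p.1, l p.2)) SD).
  exists (fun q => W (q.1.1, (1 - q.2) * q.1.2 + q.2 * l q.1.2)); split=> /=.
  - apply: (within_comp (f := fun q : 'rV[R]_m * R * R =>
       (q.1.1, (1 - q.2) * q.1.2 + q.2 * l q.1.2)) _ cW).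
      have c12 : continuous (fun q : 'rV[R]_m * R * R => q.1.2).
        by continuity_arith.
      apply: continuous_subspaceT; apply: continuous_pair.
        by continuity_arith.
      apply: continuous_add; apply: continuous_mul; try by continuity_arith.
      exact: continuous_then c12 cl.
    move=> [[u t] s] [[/= cu]]; rewrite !in_itv /= => t01 s01.
    split=> //=; have := l_in _ t01; move: t01 s01 => /andP[? ?] /andP[? ?] /andP[? ?].
    by apply/andP; split; nra.
  - move=> [u t] [/= cu]; rewrite in_itv /= => t01.
    by rewrite subr0 mul1r mul0r addr0 WP //; case/andP: t01.
  - by move=> [u t] [/= cu _]; rewrite subrr mul0r mul1r add0r.
  - move=> [u t] s [/= cu]; rewrite !in_itv /= => t01 + s01.
    case=> [->|->|bu].
    + rewrite (_ : l 0 = 0) ?mulr0 ?addr0 ?WP //.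
      by rewrite /l ifT ?mulr0 ?oppr0 //; lra.
    + rewrite (_ : l 1 = 1).
        by rewrite !mulr1 subrK WP.
      by rewrite /l ifF; [lra | apply/negbTE; rewrite -ltNge; lra].
    + rewrite Wb // ?Pb // ?in_itv //.
      have := l_in _ t01; move: t01 s01 => /andP[? ?] /andP[? ?] /andP[? ?].
      by apply/andP; split; nra.
(* It remains to deform [w] into [f \o c] on the second half of the time; the homotopy is stationary
   on the boundary of the cube, so it fits with the unchanged first half. *)
exists (fun q => if 2 * q.1.2 - 1 <= 0 then f (A (q.1.1, 2 * q.1.2))
                 else H (g q.1, q.2)); split=> /=.
- apply: within_ite.
  + by apply: continuous_subspaceT; continuity_arith.
  + apply: (within_comp (E := setT) _ (continuous_subspaceT cf)) => //.
    apply: (within_comp (f := fun q : 'rV[R]_m * R * R =>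
      (q.1.1, 2 * q.1.2)) _ cA).
      by apply: continuous_subspaceT; continuity_arith.
    move=> [[u t] s] /= [[/= [cu]]]; rewrite !in_itv /= => t01 s01 t2.
    by split=> //=; lra.
  + apply: (within_comp (f := fun q : 'rV[R]_m * R * R => (g q.1, q.2)) _ cH).
      apply: continuous_subspaceT; apply: continuous_pair.
        apply: (continuous_then (f := fst) _ cg); continuity_arith.
      by continuity_arith.
    move=> [[u t] s] /= [[/= [cu]]]; rewrite !in_itv /= => t01 s01 t2.
    by split=> //; apply: cubeE => //=; lra.
  + move=> [[u t] s] /= [[/= cu _] Is] t2.
    rewrite (_ : 2 * t = 1) ?A1 //; last lra.
    rewrite Hb // ?/w /g ?vtail_cons ?vhead_cons /=.
      by rewrite t2 mulr0 add0r WN1.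
    by apply: bdE => //; [lra | constructor 1].
- move=> [u t] [/= cu]; rewrite in_itv /= => t01; rewrite /l.
  case: ifPn => t2; first by rewrite WA ?opprK //; lra.
  rewrite -ltNge in t2; rewrite H0.
    rewrite /w /g /= vtail_cons vhead_cons; congr (W (_, _)); ring.
  by apply: cubeE => //=; lra.
- move=> [u t] [/= cu]; rewrite in_itv /= => t01.
  case: ifPn => // t2.
  rewrite -ltNge in t2; rewrite H1 //.
  by apply: cubeE => //=; lra.
- move=> [u t] s [/= cu]; rewrite in_itv /= => t01 h Is; rewrite /l.
  case: ifPn => t2; first by rewrite WA ?opprK //; lra.
  rewrite -ltNge in t2; rewrite Hb //.
    rewrite /w /g /= vtail_cons vhead_cons; congr (W (_, _)); ring.
  apply: bdE => //=; first lra.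
  by case: h => [h|h|h]; [exfalso; lra | constructor 2; lra | constructor 3].
Qed.

(** * Norms and compactness of discs and cubes *)

Lemma sqnorm_ge0 (R : realType) (m : nat) (v : 'rV[R]_m) : 0 <= sqnorm v.
Proof. by apply: sumr_ge0 => i _; exact: sqr_ge0. Qed.

Lemma sqnormZ (R : realType) (m : nat) (c : R) (v : 'rV[R]_m) :
  sqnorm (c *: v) = c ^+ 2 * sqnorm v.
Proof. by rewrite /sqnorm mulr_sumr; apply: eq_bigr => i _; rewrite mxE exprMn. Qed.

Lemma sqnorm_cons (R : realType) (m : nat) (t : R) (u : 'rV[R]_m) :
  sqnorm (vcons t u) = t ^+ 2 + sqnorm u.
Proof.
rewrite /sqnorm big_ord_recl mxE unlift_none; congr (_ + _).
by apply: eq_bigr => i _; rewrite mxE liftK.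
Qed.

Lemma sqr_coord_le (R : realType) (m : nat) (v : 'rV[R]_m) (i : 'I_m) :
  v 0 i ^+ 2 <= sqnorm v.
Proof.
rewrite /sqnorm (bigD1 i) //= lerDl.
by apply: sumr_ge0 => j _; exact: sqr_ge0.
Qed.

Lemma sqnorm_eq0 (R : realType) (m : nat) (v : 'rV[R]_m) :
  sqnorm v = 0 -> v = 0.
Proof.
move=> v0; apply/rowP => i; rewrite mxE; apply/eqP.
by rewrite -sqrf_eq0 eq_le sqr_ge0 andbT -v0 sqr_coord_le.
Qed.

Lemma continuous_sqnorm (R : realType) (m : nat) : continuous (@sqnorm R m).
Proof.
rewrite /sqnorm; apply: continuous_big => //.
  exact: add_continuous.
by move=> i _; apply: continuous_mul; exact: coord_continuous.
Qed.

Lemma rV_norm_leP (R : realType) (m : nat) (v : 'rV[R]_m) (c : R) : 0 <= c ->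
  `|v| <= c <-> forall i, `|v 0 i| <= c.
Proof.
move=> c0; rewrite [X in X <= _]/Num.norm /= mx_normrE; split.
  by move=> /bigmax_leP[_ h] i; exact: (h (0, i)).
move=> h; apply/bigmax_leP; split=> // -[i j] _ /=.
by rewrite (ord1 i).
Qed.

Lemma rV_norm_attained (R : realType) (m : nat) (v : 'rV[R]_m) :
  `|v| != 0 -> exists i, `|v| = `|v 0 i|.
Proof. by move=> /mx_norm_neq0[[i j]] /= h; exists j; rewrite -(ord1 i). Qed.

Lemma sphere_sub_disc (R : realType) (d : nat) : sphere R d `<=` disc R d.
Proof. by move=> v; rewrite /sphere /disc /= => ->. Qed.

Lemma disc_compact (R : realType) (d : nat) : compact (disc R d).
Proof.
apply: bounded_closed_compact.
  exists 1; split => // M M1 v /= v1; apply/rV_norm_leP.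
    by apply: ltW; apply: lt_trans M1.
  move=> i; apply: le_trans (ltW M1).
  rewrite -(@expr_le1 _ 2) // real_normK ?num_real //.
  exact: le_trans (sqr_coord_le _ _) v1.
rewrite (_ : disc R d = (@sqnorm R d) @^-1` [set x | x <= 1]) //.
by apply: preimage_closed; [move=> ? _; exact: continuous_sqnorm | exact: closed_le].
Qed.

Lemma cube_compact (R : realType) (m : nat) : compact (cube R m).
Proof.
apply: (@rV_compact R m (fun=> `[0, 1]%classic)) => _; exact: segment_compact.
Qed.

Lemma continuous_scale (R : realType) (X : topologicalType) (m : nat)
    (c : X -> R) (v : X -> 'rV[R]_m) :
  continuous c -> continuous v -> continuous (fun x => c x *: v x).
Proof. by move=> cc cv x; apply: cvgZ; [exact: cc | exact: cv]. Qed.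

Lemma continuous_inv (R : realType) (X : topologicalType) (c : X -> R) :
  (forall x, c x != 0) -> continuous c -> continuous (fun x => (c x)^-1).
Proof. by move=> c0 cc x; apply: cvgV; [exact: c0 | exact: cc]. Qed.

(** Row vectors carry the maximum norm, so this affine map takes the cube to the unit ball of the
    norm and its boundary to the unit sphere. *)
Definition center (R : realType) (m : nat) (u : 'rV[R]_m) : 'rV[R]_m :=
  2 *: u - const_mx 1.

Lemma center_inj (R : realType) (m : nat) : injective (@center R m).
Proof.
move=> u v /addIr/rowP h; apply/rowP => i; have := h i; rewrite !mxE => ?; lra.
Qed.

Lemma cube_center (R : realType) (m : nat) (u : 'rV[R]_m) :
  cube R m u <-> `|center u| <= 1.
Proof.
rewrite rV_norm_leP //; split=> h i; have := h i; rewrite !mxE in_itv ler_norml /=.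
  by move=> ?; lra.
by move=> ?; lra.
Qed.

Lemma cube_boundary_center (R : realType) (m : nat) (u : 'rV[R]_m) :
  cube_boundary R m u <-> `|center u| = 1.
Proof.
split=> [[/cube_center cu [i ui]]|u1].
  apply/eqP; rewrite eq_le cu /=.
  have : `|center u 0 i| <= `|center u|.
    exact: (proj1 (rV_norm_leP _ (normr_ge0 _)) (lexx _) i).
  apply: le_trans; rewrite !mxE; case: ui => ->.
    by rewrite mulr0 sub0r normrN normr1.
  by rewrite mulr1 (_ : 2 - 1 = 1) ?normr1 //; ring.
split; first by apply/cube_center; rewrite u1.
have [|i] := @rV_norm_attained _ _ (center u); first by rewrite u1 oner_neq0.
rewrite u1 !mxE => /esym; case: (lerP 0 (2 * u 0 i - 1)) => h.
  by rewrite ger0_norm // => ?; exists i; right; lra.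
by rewrite ltr0_norm // => ?; exists i; left; lra.
Qed.

(** * Collapsing a cube onto a disc *)

(** The denominator 1 + |w/s|^2 of inverse stereographic projection at w/s, multiplied by s^2. It
    stays positive at s = 0 because [w] is then nonzero, so the point at infinity needs no separate
    case. *)
Definition stereo_denom (R : realType) (m : nat) (u : 'rV[R]_m) : R :=
  (1 - `|center u|) ^+ 2 + sqnorm (center u).

Definition cone_scale (R : realType) (m : nat) (z : 'rV[R]_m.+1) : R :=
  2 * (1 - vhead z) / stereo_denom (vtail z).

(* With t = vhead z, w = center (vtail z) and s = 1 - |w| (maximum norm), the
   point w / s of R^m (infinity if s = 0) is sent to the sphere by inverse
   stereographic projection from the pole (1, 0), and t moves along the segment
   from the resulting point to the pole. The denominators s cancel out. *)
Definition cube_to_disc (R : realType) (m : nat) (z : 'rV[R]_m.+1) :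
    'rV[R]_m.+1 :=
  let s := 1 - `|center (vtail z)| in
  vcons (1 - cone_scale z * s ^+ 2) ((cone_scale z * s) *: center (vtail z)).

Lemma stereo_denom_gt0 (R : realType) (m : nat) (u : 'rV[R]_m) :
  0 < stereo_denom u.
Proof.
have s0 := sqr_ge0 (1 - `|center u|); have q0 := sqnorm_ge0 (center u).
rewrite lt_def addr_ge0 // andbT; apply/eqP => /eqP.
rewrite paddr_eq0 // => /andP[/eqP h /eqP /sqnorm_eq0 u0].
by move: h; rewrite u0 normr0 subr0 expr1n => /eqP; rewrite oner_eq0.
Qed.

Lemma continuous_center (R : realType) (m : nat) : continuous (@center R m).
Proof.
apply: continuous_rV => i.
have -> : (fun u : 'rV[R]_m => center u 0 i) = (fun u => 2 * u 0 i - 1).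
  by apply/funext => u; rewrite !mxE.
apply: continuous_add; last exact: cst_continuous.
by apply: continuous_mul; [exact: cst_continuous | exact: coord_continuous].
Qed.

Lemma continuous_cube_to_disc (R : realType) (m : nat) :
  continuous (@cube_to_disc R m).
Proof.
have cc : continuous (fun z : 'rV[R]_m.+1 => center (vtail z)).
  exact: (continuous_then (@continuous_vtail R m) (@continuous_center R m)).
have cs : continuous (fun z : 'rV[R]_m.+1 => 1 - `|center (vtail z)|).
  apply: continuous_add; first exact: cst_continuous.
  apply: continuous_opp; apply: (continuous_then cc); exact: norm_continuous.
have cr : continuous (@cone_scale R m).
  apply: continuous_mul.
    apply: continuous_mul; first exact: cst_continuous.
    apply: continuous_add; first exact: cst_continuous.
    apply: continuous_opp; exact: continuous_vhead.
  apply: continuous_inv => [z|]; first exact: lt0r_neq0 (stereo_denom_gt0 _).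
  apply: continuous_add; first exact: (continuous_mul cs cs).
  exact: continuous_then cc (@continuous_sqnorm R m).
apply: (continuous_then (f := fun z => (_, _)) _ (@continuous_vcons R m)).
apply: continuous_pair.
  apply: continuous_add; first exact: cst_continuous.
  apply: continuous_opp; apply: (continuous_mul cr); exact: (continuous_mul cs cs).
apply: continuous_scale cc; exact: (continuous_mul cr cs).
Qed.

(** With r = [cone_scale z] and D the denominator, r D = 2(1 - t), so the quadratic part r^2 s^2 D
    of the expansion equals 2(1 - t) r s^2. Nonnegativity of the subtracted term on the cube gives
    the disc, and its vanishing characterizes the sphere. *)
Lemma sqnorm_cube_to_disc (R : realType) (m : nat) (z : 'rV[R]_m.+1) :
  sqnorm (cube_to_disc z) =
  1 - 2 * (cone_scale z * (1 - `|center (vtail z)|) ^+ 2 * vhead z).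
Proof.
rewrite sqnorm_cons sqnormZ /cone_scale.
have := stereo_denom_gt0 (vtail z); rewrite /stereo_denom.
move: (sqnorm _) (`|_|) (vhead z) => q c t h; field.
exact: lt0r_neq0.
Qed.

(** All closed faces except the bottom one [vhead z = 0]. This is the fibre of [cube_to_disc] over
    the pole [vcons 1 0], and the only place where injectivity fails. *)
Definition cone_edge (R : realType) (m : nat) : set 'rV[R]_m.+1 :=
  [set z | cube R m.+1 z /\ (vhead z = 1 \/ cube_boundary R m (vtail z))].
Arguments cone_edge R m : clear implicits.

Lemma cone_edgeP (R : realType) (m : nat) (z : 'rV[R]_m.+1) : cube R m.+1 z ->
  cone_edge R m z <-> cone_scale z * (1 - `|center (vtail z)|) ^+ 2 = 0.
Proof.
move=> cz; rewrite /cone_scale; have d0 := stereo_denom_gt0 (vtail z); split.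
  move=> [_ [->|/cube_boundary_center ->]]; first by rewrite subrr mulr0 !mul0r.
  by rewrite subrr expr0n mulr0.
move/eqP; rewrite !mulf_eq0 invr_eq0 (gt_eqF d0) pnatr_eq0 orbF /= => h.
split=> //; case/orP: h => [/eqP h|h]; first by left; lra.
right; apply/cube_boundary_center; move: h; rewrite orbb => /eqP ?; lra.
Qed.

Lemma cone_scale_ge0 (R : realType) (m : nat) (z : 'rV[R]_m.+1) :
  cube R m.+1 z -> 0 <= cone_scale z.
Proof.
move=> /cube_cons[z1 _]; apply: divr_ge0; first by lra.
exact: ltW (stereo_denom_gt0 _).
Qed.

Lemma cube_to_disc_disc (R : realType) (m : nat) (z : 'rV[R]_m.+1) :
  cube R m.+1 z -> disc R m.+1 (cube_to_disc z).
Proof.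
move=> cz; rewrite /disc /= sqnorm_cube_to_disc.
have /cube_cons[z1 _] := cz; case/andP: z1 => z0 z1.
have r0 := cone_scale_ge0 cz; have s0 := sqr_ge0 (1 - `|center (vtail z)|).
have := mulr_ge0 (mulr_ge0 r0 s0) z0; lra.
Qed.

Lemma cube_to_disc_sphere (R : realType) (m : nat) (z : 'rV[R]_m.+1) :
  cube R m.+1 z ->
  sphere R m.+1 (cube_to_disc z) <-> cube_boundary R m.+1 z.
Proof.
move=> cz; rewrite /sphere /= sqnorm_cube_to_disc cube_boundary_cons; split.
  move=> h; split=> //.
  have /eqP : cone_scale z * (1 - `|center (vtail z)|) ^+ 2 * vhead z = 0 by lra.
  rewrite mulf_eq0 => /orP[/eqP/(cone_edgeP cz)[_ []]|/eqP] ?.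
  - by constructor 2.
  - by constructor 3.
  - by constructor 1.
move=> [_ [->|h|h]]; first by rewrite !mulr0 subr0.
- rewrite (proj1 (cone_edgeP cz)) ?mul0r ?mulr0 ?subr0 //.
  by split=> //; left.
- rewrite (proj1 (cone_edgeP cz)) ?mul0r ?mulr0 ?subr0 //.
  by split=> //; right.
Qed.

Lemma cube_to_disc_edge (R : realType) (m : nat) (z : 'rV[R]_m.+1) :
  cone_edge R m z -> cube_to_disc z = vcons 1 0.
Proof.
move=> ez; have [cz _] := ez; have e0 := proj1 (cone_edgeP cz) ez.
rewrite /cube_to_disc e0 subr0; congr vcons.
move/eqP: e0; rewrite mulf_eq0 sqrf_eq0 => /orP[] /eqP ->.
  by rewrite mul0r scale0r.
by rewrite mulr0 scale0r.
Qed.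

(** The head of the image determines k = r s^2. If k is nonzero, dividing the tail by k recovers
    w/s; its maximum norm (1 - s)/s = 1/s - 1 determines s, hence w, then r, and finally t. *)
Lemma cube_to_disc_inj (R : realType) (m : nat) (z z' : 'rV[R]_m.+1) :
  cube R m.+1 z -> cube R m.+1 z' -> cube_to_disc z = cube_to_disc z' ->
  z = z' \/ cone_edge R m z /\ cone_edge R m z'.
Proof.
move=> cz cz' E.
have Eh := congr1 (@vhead R m) E; have Et := congr1 (@vtail R m) E.
rewrite !vhead_cons in Eh; rewrite !vtail_cons in Et.
have {}Eh : cone_scale z * (1 - `|center (vtail z)|) ^+ 2 =
    cone_scale z' * (1 - `|center (vtail z')|) ^+ 2 by lra.
have [k0|k0] := eqVneq (cone_scale z * (1 - `|center (vtail z)|) ^+ 2) 0.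
  right; split; first exact/(cone_edgeP cz).
  by apply/(cone_edgeP cz'); rewrite -Eh.
left.
have k0' := k0; rewrite Eh in k0'.
have r0 : cone_scale z != 0 by apply: contraNneq k0 => ->; rewrite mul0r.
have r0' : cone_scale z' != 0 by apply: contraNneq k0' => ->; rewrite mul0r.
have s0 : 1 - `|center (vtail z)| != 0.
  by apply: contraNneq k0 => ->; rewrite expr0n mulr0.
have s0' : 1 - `|center (vtail z')| != 0.
  by apply: contraNneq k0' => ->; rewrite expr0n mulr0.
pose s := 1 - `|center (vtail z)|; pose s' := 1 - `|center (vtail z')|.
have Ew : s^-1 *: center (vtail z) = s'^-1 *: center (vtail z').
  have Er : (cone_scale z * s ^+ 2)^-1 *: ((cone_scale z * s) *: center (vtail z)) =
      (cone_scale z' * s' ^+ 2)^-1 *: ((cone_scale z' * s') *: center (vtail z')).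
    by rewrite /s /s' Et Eh.
  move: Er; rewrite !scalerA.
  have -> : (cone_scale z * s ^+ 2)^-1 * (cone_scale z * s) = s^-1.
    by field; rewrite r0 s0.
  by have -> : (cone_scale z' * s' ^+ 2)^-1 * (cone_scale z' * s') = s'^-1;
    first by field; rewrite r0' s0'.
have [/cube_cons[z1 /cube_center n1] /cube_cons[z1' /cube_center n1']] := (cz, cz').
have sp : 0 < s by rewrite lt_def s0 subr_ge0.
have sp' : 0 < s' by rewrite lt_def s0' subr_ge0.
have key (x y : R) : x != 0 -> y != 0 ->
    x^-1 * (1 - x) = y^-1 * (1 - y) -> x = y.
  by move=> x0 y0; rewrite !mulrBr !mulr1 !mulVf // => /addIr/invr_inj.
have Es : s = s'.
  have := congr1 Num.norm Ew; rewrite !normrZ.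
  rewrite !ger0_norm ?invr_ge0 ?ltW //.
  have -> : `|center (vtail z)| = 1 - s by rewrite subKr.
  have -> : `|center (vtail z')| = 1 - s' by rewrite subKr.
  exact: key.
have Eu : vtail z = vtail z'.
  by apply: center_inj; move: Ew; rewrite Es => /(scalerI (invr_neq0 s0')).
rewrite -[z]vcons_eta -[z']vcons_eta Eu; congr vcons.
have {}Eh : cone_scale z = cone_scale z'.
  by apply: (mulIf (expf_neq0 2 s0')); rewrite -Eh -/s -/s' Es.
move: Eh; rewrite /cone_scale Eu => /(mulIf _) h.
have := h (invr_neq0 (lt0r_neq0 (stereo_denom_gt0 _))) => ?; lra.
Qed.

Lemma cube_to_disc_surj (R : realType) (m : nat) (p : 'rV[R]_m.+1) :
  disc R m.+1 p -> exists2 z, cube R m.+1 z & cube_to_disc z = p.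
Proof.
rewrite -[p]vcons_eta /disc /= sqnorm_cons.
set a := vhead p; set v := vtail p => av.
have v0 := sqnorm_ge0 v.
have [a1|a1] := eqVneq a 1.
  exists (vcons 1 0).
    apply/cube_cons; rewrite vhead_cons vtail_cons; split; first by lra.
    by move=> i; rewrite mxE in_itv /= lexx ler01.
  rewrite cube_to_disc_edge; last first.
    split; last by left; rewrite vhead_cons.
    apply/cube_cons; rewrite vhead_cons vtail_cons; split; first by lra.
    by move=> i; rewrite mxE in_itv /= lexx ler01.
  rewrite a1; congr vcons; apply/esym/sqnorm_eq0; move: av; rewrite a1; lra.
have {}a1 : 0 < 1 - a.
  rewrite subr_gt0 lt_def eq_sym a1 /=.
  by move: v0 av; nra.
pose w := (1 - a)^-1 *: v.
(* The line from the pole through the point meets the equatorial hyperplane in [w], which must be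
   the quotient of [center u] by 1 - |[center u]|; this forces the value of [s]. *)
pose s := (1 + `|w|)^-1.
have w1 : 0 < 1 + `|w| by rewrite ltr_wpDr.
have s0 : 0 < s by rewrite invr_gt0.
pose u := 2^-1 *: (s *: w + const_mx 1).
have cu : center u = s *: w by rewrite /center scalerA divff // scale1r addrK.
have ncu : `|center u| = 1 - s.
  rewrite cu normrZ ger0_norm ?ltW // /s; field; exact: lt0r_neq0.
have sw : sqnorm w = (1 - a) ^- 2 * sqnorm v by rewrite sqnormZ exprVn.
(* The solution of [cone_scale (vcons t u) * s ^+ 2 = 1 - a]. The condition 0 <= t amounts to a^2 +
   |v|^2 <= 1, that is, to the point lying in the disc. *)
pose t := 1 - ((1 - a) ^+ 2 + sqnorm v) / (2 * (1 - a)).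
have d_E : stereo_denom u = s ^+ 2 * (1 + sqnorm w).
  by rewrite /stereo_denom ncu cu sqnormZ; ring.
have r_E : cone_scale (vcons t u) * s ^+ 2 = 1 - a.
  rewrite /cone_scale vhead_cons vtail_cons d_E sw /t.
  field; rewrite !lt0r_neq0 //=.
  have := sqr_ge0 (1 - a).
  by nra.
exists (vcons t u).
  apply/cube_cons; rewrite vhead_cons vtail_cons; split; last first.
    by apply/cube_center; rewrite ncu; lra.
  rewrite /t subr_ge0 ler_pdivrMr; last lra.
  rewrite gerBl divr_ge0 ?andbT; [nra | by rewrite addr_ge0 ?sqr_ge0 | lra].
rewrite /cube_to_disc vtail_cons ncu subKr r_E subKr; congr vcons.
rewrite cu scalerA -mulrA -expr2 r_E /w scalerA divff ?scale1r //.
exact: lt0r_neq0.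
Qed.

(** * Compression of discs *)

Lemma disc_image (R : realType) (m : nat) :
  @cube_to_disc R m @` cube R m.+1 = disc R m.+1.
Proof.
apply/seteqP; split=> [_ [z cz <-]|p /cube_to_disc_surj[z cz <-]].
  exact: cube_to_disc_disc.
by exists z.
Qed.

(** Here the sphere is empty and the disc and the cube are the same single point, so surjectivity on
    path components is all that is used. *)
Lemma compression_disc0 (R : realType) (n : nat) (B Y : topologicalType)
    (f : B -> Y) (b : B) (psi : 'rV[R]_0 -> B) (phi : 'rV[R]_0 -> Y) :
  continuous f -> n_equivalence R n f ->
  exists psi' : 'rV[R]_0 -> B,
    [/\ {within disc R 0, continuous psi'},
        forall v, sphere R 0 v -> psi' v = psi v &
        homotopic_rel R (disc R 0) (sphere R 0) phi (f \o psi')].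
Proof.
move=> cf nf.
have S0 v : ~ sphere R 0 v.
  by rewrite /sphere /= /sqnorm big_ord0 => /eqP; rewrite eq_sym oner_eq0.
have [|a [ca _] fa] := @n_equivalence_surj R n 0 B Y f b (cst (phi 0)) cf nf
    (leq0n n).
  split; first by apply: continuous_subspaceT; exact: cst_continuous.
  by move=> v [_ [[]]].
exists a; split=> [|v /S0 //|].
  by apply: continuous_subspaceW ca => v _ [].
apply: homotopic_rel_sym => [v /S0 //|].
apply: (homotopic_rel_ext (f := f \o a) (g := cst (phi 0))) => //.
- by move=> v /S0.
- by move=> v _; rewrite (thinmx0 v).
apply: (homotopic_rel_precomp (h := id) _ _ _ fa).
- by apply: continuous_subspaceT; exact: continuous_idfun.
- by move=> v _ [].
- by move=> v /S0.
Qed.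

Lemma compression_disc (R : realType) (n d : nat) (B Y : topologicalType)
    (f : B -> Y) (b0 : B) (psi : 'rV[R]_d -> B) (phi : 'rV[R]_d -> Y) :
  continuous f -> n_equivalence R n f -> (d <= n)%N ->
  {within sphere R d, continuous psi} -> {within disc R d, continuous phi} ->
  (forall v, sphere R d v -> phi v = f (psi v)) ->
  exists psi' : 'rV[R]_d -> B,
    [/\ {within disc R d, continuous psi'},
        forall v, sphere R d v -> psi' v = psi v &
        homotopic_rel R (disc R d) (sphere R d) phi (f \o psi')].
Proof.
case: d psi phi => [|m] psi phi cf nf mn cpsi cphi pf.
  exact: (compression_disc0 b0).
have SD := @sphere_sub_disc R m.+1.
have cubeE u t : cube R m u -> t \in `[0, 1] -> cube R m.+1 (vcons t u).
  by move=> cu; rewrite in_itv => t01; apply/cube_cons; rewrite vhead_cons vtail_cons.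
have I0 : (0 : R) \in `[0, 1] by rewrite in_itv /= ler01 lexx.
have I1 : (1 : R) \in `[0, 1] by rewrite in_itv /= ler01 lexx.
have bd0 u : cube R m u -> cube_boundary R m.+1 (vcons 0 u).
  move=> cu; apply/cube_boundary_cons; rewrite vhead_cons; split; last by constructor 1.
  exact: cubeE.
have edge1 u : cube R m u -> cube_to_disc (vcons 1 u) = vcons 1 0.
  move=> cu; apply: cube_to_disc_edge; split; first exact: cubeE.
  by rewrite vhead_cons; left.
have edgeb u t : cube_boundary R m u -> t \in `[0, 1] ->
    cube_to_disc (vcons t u) = vcons 1 0.
  move=> bu It; apply: cube_to_disc_edge; split.
    by apply: cubeE => //; case: bu.
  by rewrite vtail_cons; right.
have pole : sphere R m.+1 (vcons 1 0).
  rewrite /sphere /= sqnorm_cons expr1n /sqnorm big1 ?addr0 // => i _.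
  by rewrite mxE expr0n.
pose b := psi (vcons 1 0).
(* The bottom face covers the sphere with its own boundary sent to the pole, so [psi] becomes a
   spheroid based at the image of the pole. *)
pose a (u : 'rV[R]_m) := psi (cube_to_disc (vcons 0 u)).
pose P (p : 'rV[R]_m * R) := phi (cube_to_disc (vcons p.2 p.1)).
have cQ : continuous (fun p : 'rV[R]_m * R => cube_to_disc (vcons p.2 p.1)).
  apply: (continuous_then (f := fun p : 'rV[R]_m * R => vcons p.2 p.1) _
    (@continuous_cube_to_disc R m)).
  apply: (continuous_then (f := fun p : 'rV[R]_m * R => (p.2, p.1)) _
    (@continuous_vcons R m)).
  by continuity_arith.
have sa : spheroid R m b a.
  split.
    apply: (within_comp (f := fun u => cube_to_disc (vcons 0 u)) _ cpsi).
      apply: continuous_subspaceT.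
      apply: (continuous_then (f := fun u : 'rV[R]_m => (u, 0)) _ cQ).
      by continuity_arith.
    by move=> u cu; apply/cube_to_disc_sphere; [exact: cubeE | exact: bd0].
  by move=> u bu; rewrite /a edgeb.
have [||||Psi [cPsi Psi0 Psi1 Psib [G [cG G0 G1 GS]]]] :=
    compression_cube (P := P) cf nf mn sa.
- apply: (within_comp (continuous_subspaceT cQ) cphi).
  move=> [u t] [/= cu It]; apply: cube_to_disc_disc; exact: cubeE.
- move=> u cu; rewrite /P /= pf //.
  by apply/cube_to_disc_sphere; [exact: cubeE | exact: bd0].
- by move=> u cu; rewrite /P /= edge1 // pf.
- by move=> u t bu It; rewrite /P /= edgeb // pf.
(* The section is arbitrary and not continuous. It only serves to write down maps on the disc; their
   continuity comes from compactness of the cube, once they are known to factor through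
   [cube_to_disc]. *)
have [sec secP] : exists sec : 'rV[R]_m.+1 -> 'rV[R]_m.+1,
    forall p, disc R m.+1 p -> cube R m.+1 (sec p) /\ cube_to_disc (sec p) = p.
  have /choice[sec secP] : forall p : 'rV[R]_m.+1, exists z, disc R m.+1 p ->
      cube R m.+1 z /\ cube_to_disc z = p.
    move=> p; have [/cube_to_disc_surj[z cz zp]|np] := pselect (disc R m.+1 p).
      by exists z.
    by exists 0.
  by exists sec.
pose tlhd (z : 'rV[R]_m.+1) := (vtail z, vhead z).
have ctlhd : continuous tlhd.
  exact: (continuous_pair (@continuous_vtail R m) (@continuous_vhead R m)).
have tlhdD z : cube R m.+1 z -> (cube R m `*` (`[0, 1] : set R)) (tlhd z).
  by move=> /cube_cons[z1 cz]; split=> //=; rewrite in_itv.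
(* A function constant on [cone_edge] does not depend on the choice of preimage, so it descends to
   the disc. This applies to [Psi] and, since [G] is stationary there, to [G] at each time. *)
have edge_const T (F : 'rV[R]_m * R -> T) (y : T) :
    (forall u, cube R m u -> F (u, 1) = y) ->
    (forall u t, cube_boundary R m u -> t \in `[0, 1] -> F (u, t) = y) ->
    forall z, cube R m.+1 z -> F (tlhd (sec (cube_to_disc z))) = F (tlhd z).
  move=> F1 Fb z cz.
  have [cs sE] := secP _ (cube_to_disc_disc cz).
  have Fedge z' : cone_edge R m z' -> F (tlhd z') = y.
    move=> [/tlhdD[/= cz' Iz']] [h|bz].
      by rewrite /tlhd h F1.
    exact: Fb.
  have [-> //|[e1 e2]] := cube_to_disc_inj cs cz sE.
  by rewrite !Fedge.
have Psi_sec := edge_const _ Psi b Psi1 Psib.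
have GE s : s \in `[0, 1] -> forall z, cube R m.+1 z ->
    G (tlhd (sec (cube_to_disc z)), s) = G (tlhd z, s).
  move=> Is; apply: (edge_const _ (fun p => G (p, s)) (f b)).
    move=> u cu; rewrite GS //; last by split=> //; constructor 2.
    by rewrite /P /= edge1 // pf.
  move=> u t bu It; rewrite GS //; first by rewrite /P /= edgeb // pf.
  by split=> //; [case: bu | constructor 3].
have hV : hausdorff_space 'rV[R]_m.+1 by exact: norm_hausdorff.
exists (fun p => Psi (tlhd (sec p))); split.
- rewrite -disc_image; apply: within_image => //; first exact: cube_compact.
    by apply: continuous_subspaceT; exact: continuous_cube_to_disc.
  apply: (within_ext (f := fun z => Psi (tlhd z))).
    by move=> z cz; rewrite Psi_sec.
  exact: (within_comp (continuous_subspaceT ctlhd) cPsi).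
- move=> p sp; have [cs sE] := secP _ (SD _ sp).
  have := sp; rewrite -{1}sE => /(cube_to_disc_sphere cs)/cube_boundary_cons[_].
  have /tlhdD[/= ct Ih] := cs; rewrite /tlhd; case=> [h|h|bz].
  + by rewrite h Psi0 // /a -h vcons_eta sE.
  + by rewrite h Psi1 // /b -sE cube_to_disc_edge //; split=> //; left.
  + by rewrite Psib // /b -sE cube_to_disc_edge //; split=> //; right.
- exists (fun q => G (tlhd (sec q.1), q.2)); split=> /=.
  + have -> : disc R m.+1 `*` (`[0, 1] : set R) =
      (fun q : 'rV[R]_m.+1 * R => (cube_to_disc q.1, q.2)) @`
      (cube R m.+1 `*` (`[0, 1] : set R)).
      apply/seteqP; split.
        by move=> [p s] [/= /cube_to_disc_surj[z cz <-] Is]; exists (z, s).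
      by move=> _ [[z s] [/= cz Is] <-]; split=> //=; exact: cube_to_disc_disc.
    apply: within_image.
    * by apply: hausdorff_prod => //; exact: Rhausdorff.
    * by apply: compact_setX; [exact: cube_compact | exact: segment_compact].
    * apply: continuous_subspaceT; apply: continuous_pair; last by continuity_arith.
      apply: (continuous_then (f := fst) _ (@continuous_cube_to_disc R m)).
      by continuity_arith.
    * apply: (within_ext (f := fun q : 'rV[R]_m.+1 * R => G (tlhd q.1, q.2))).
        by move=> [z s] [/= cz Is]; rewrite GE.
      apply: (within_comp (f := fun q : 'rV[R]_m.+1 * R => (tlhd q.1, q.2)) _ cG).
        apply: continuous_subspaceT; apply: continuous_pair; last by continuity_arith.
        by apply: (continuous_then (f := fst) _ ctlhd); continuity_arith.
      by move=> [z s] [/= cz Is]; split=> //; exact: tlhdD.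
  + move=> p dp; have [cs sE] := secP _ dp.
    by rewrite G0 ?/P /= ?vcons_eta ?sE //; exact: tlhdD.
  + by move=> p dp; have [cs sE] := secP _ dp; rewrite G1 //; exact: tlhdD.
  + move=> p s sp Is; have [cs sE] := secP _ (SD _ sp).
    rewrite GS //; first by rewrite /P /= vcons_eta sE.
    have /tlhdD[/= ct Ih] := cs; split=> //=.
    have := sp; rewrite -{1}sE => /(cube_to_disc_sphere cs)/cube_boundary_cons[_].
    by case=> ?; [constructor 1 | constructor 2 | constructor 3].
Qed.

(** * Homotopy extension and relative lifting for discs *)

Lemma within_inv (R : realType) (X : topologicalType) (D : set X) (c : X -> R) :
  (forall x, D x -> c x != 0) -> {within D, continuous c} ->
  {within D, continuous (fun x => (c x)^-1)}.
Proof.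
move=> c0 /subspace_continuousP cc; apply/subspace_continuousP => x Dx.
by apply: cvgV; [exact: c0 | exact: cc].
Qed.

Lemma within_scale (R : realType) (X : topologicalType) (m : nat) (D : set X)
    (c : X -> R) (v : X -> 'rV[R]_m) :
  {within D, continuous c} -> {within D, continuous v} ->
  {within D, continuous (fun x => c x *: v x)}.
Proof.
move=> /subspace_continuousP cc /subspace_continuousP cv.
by apply/subspace_continuousP => x Dx; apply: cvgZ; [exact: cc | exact: cv].
Qed.

Definition l2norm (R : realType) (d : nat) (v : 'rV[R]_d) : R :=
  Num.sqrt (sqnorm v).

Lemma continuous_l2norm (R : realType) (d : nat) : continuous (@l2norm R d).
Proof.
apply: (continuous_then (@continuous_sqnorm R d)); exact: sqrt_continuous.
Qed.

Lemma sqr_l2norm (R : realType) (d : nat) (v : 'rV[R]_d) :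
  l2norm v ^+ 2 = sqnorm v.
Proof. by rewrite sqr_sqrtr ?sqnorm_ge0. Qed.

Lemma l2norm_ge0 (R : realType) (d : nat) (v : 'rV[R]_d) : 0 <= l2norm v.
Proof. exact: sqrtr_ge0. Qed.

Lemma disc_l2norm (R : realType) (d : nat) (v : 'rV[R]_d) :
  disc R d v <-> l2norm v <= 1.
Proof. by rewrite /disc /= -sqr_l2norm expr_le1 ?l2norm_ge0. Qed.

Lemma sphere_l2norm (R : realType) (d : nat) (v : 'rV[R]_d) :
  sphere R d v <-> l2norm v = 1.
Proof.
rewrite /sphere /= -sqr_l2norm; split=> [/eqP|->]; last by rewrite expr1n.
by rewrite sqrf_eq1 => /orP[/eqP //|/eqP h]; have := l2norm_ge0 v; rewrite h; lra.
Qed.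

Lemma l2normZ (R : realType) (d : nat) (c : R) (v : 'rV[R]_d) :
  0 <= c -> l2norm (c *: v) = c * l2norm v.
Proof. by move=> c0; rewrite /l2norm sqnormZ sqrtrM ?sqr_ge0 // sqrtr_sqr ger0_norm. Qed.

(* The homotopy h is placed on a collar of the disc dilated by 1 + t. *)
Lemma disc_homotopy_extension (R : realType) (d : nat) (Y : topologicalType)
    (phi : 'rV[R]_d -> Y) (h : 'rV[R]_d * R -> Y) :
  {within disc R d, continuous phi} ->
  {within sphere R d `*` `[0, 1], continuous h} ->
  (forall v, sphere R d v -> h (v, 0) = phi v) ->
  exists k : 'rV[R]_d * R -> Y,
    [/\ {within disc R d `*` `[0, 1], continuous k},
        forall v, disc R d v -> k (v, 0) = phi v &
        forall v t, sphere R d v -> t \in `[0, 1] -> k (v, t) = h (v, t)].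
Proof.
move=> cphi ch h0.
pose N (p : 'rV[R]_d * R) := l2norm p.1.
have cN : continuous N.
  by apply: (continuous_then (f := fst) _ (@continuous_l2norm R d)); continuity_arith.
have c1 : continuous (fun p : 'rV[R]_d * R => 1 + p.2) by continuity_arith.
(* The amount by which the dilated point leaves the disc. It serves as the time in [h] at the radial
   projection; it is at most [t] on the disc and equal to [t] on the sphere. Where it vanishes,
   [(N p)^-1] is 1 + t and the two formulas agree. *)
pose c p := N p * (1 + p.2) - 1.
have cc : continuous c.
  by apply: continuous_add; [exact: (continuous_mul cN c1) | exact: cst_continuous].
exists (fun p => if c p <= 0 then phi ((1 + p.2) *: p.1)
                 else h ((N p)^-1 *: p.1, c p)); split => /=.
- apply: within_ite.
  + exact: continuous_subspaceT.
  + apply: (within_comp (f := fun p : 'rV[R]_d * R => (1 + p.2) *: p.1) _ cphi).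
      by apply: continuous_subspaceT; apply: continuous_scale => //; continuity_arith.
    move=> [v t] /= [[/= dv]]; rewrite in_itv /= => t01.
    rewrite /c /N /= subr_le0 => cle.
    by apply/disc_l2norm; rewrite l2normZ 1?mulrC //; lra.
  + have Np v t : (0 : R) <= t <= 1 -> 0 <= c (v, t) -> 0 < N (v, t).
      rewrite /c /N /= => t01; rewrite subr_ge0 => cge.
      rewrite lt_def l2norm_ge0 andbT; apply/eqP => N0.
      by move: cge; rewrite N0 mul0r; lra.
    apply: (within_comp (f := fun p : 'rV[R]_d * R => ((N p)^-1 *: p.1, c p)) _ ch).
      apply: within_pair; last exact: continuous_subspaceT.
      apply: within_scale; last by apply: continuous_subspaceT; continuity_arith.
      apply: within_inv; last exact: continuous_subspaceT.
      move=> [v t] [[/= _]]; rewrite in_itv /= => t01 cge.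
      by rewrite lt0r_neq0 // Np.
    move=> [v t] [[/= dv]]; rewrite in_itv /= => t01 cge.
    have N0 := Np _ _ t01 cge.
    split=> /=.
      apply/sphere_l2norm; rewrite l2normZ ?invr_ge0 ?ltW // mulVf //.
      exact: lt0r_neq0.
    rewrite in_itv /= cge /=; move/disc_l2norm: dv; rewrite /c /N /= => dv.
    have := l2norm_ge0 v; case/andP: t01 => *; nra.
  + move=> [v t] [/= dv]; rewrite in_itv /= => t01 ct0.
    have N0 : N (v, t) != 0.
      by apply/eqP => N0; move: ct0; rewrite /c N0 mul0r; lra.
    have NE : (N (v, t))^-1 = 1 + t.
      by apply: (mulfI N0); rewrite divff //; move: ct0; rewrite /c /=; lra.
    rewrite ct0 h0 NE //; apply/sphere_l2norm; rewrite l2normZ; last by lra.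
    by move: ct0; rewrite /c /N /= mulrC; lra.
- move=> v /disc_l2norm Nv; rewrite ifT ?addr0 ?scale1r // /c /N /=.
  by rewrite addr0 mulr1; lra.
- move=> v t sv; rewrite in_itv /= => t01.
  have cE : c (v, t) = t.
    by rewrite /c /N /= (proj1 (sphere_l2norm v) sv) mul1r addrC addrA addNr add0r.
  rewrite cE /N /= (proj1 (sphere_l2norm v) sv) invr1 scale1r.
  case: ifPn => // t0.
  by rewrite (_ : t = 0) ?addr0 ?scale1r ?h0 //; lra.
Qed.

(* On the sphere, h' runs through h at double speed and then stands still: the
   second half of the time is used for the compression relative to the
   sphere. *)
Lemma relative_lifting (R : realType) (n d : nat) (B Y : topologicalType)
    (f : B -> Y) (b0 : B) (psi : 'rV[R]_d -> B) (phi : 'rV[R]_d -> Y)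
    (h : 'rV[R]_d * R -> Y) :
  continuous f -> n_equivalence R n f -> (d <= n)%N ->
  {within sphere R d, continuous psi} -> {within disc R d, continuous phi} ->
  {within sphere R d `*` `[0, 1], continuous h} ->
  (forall v, sphere R d v -> h (v, 0) = phi v) ->
  (forall v, sphere R d v -> h (v, 1) = f (psi v)) ->
  exists (psi' : 'rV[R]_d -> B) (h' : 'rV[R]_d * R -> Y),
    [/\ {within disc R d, continuous psi'},
        {within disc R d `*` `[0, 1], continuous h'},
        forall v, disc R d v -> h' (v, 0) = phi v /\ h' (v, 1) = f (psi' v),
        forall v, sphere R d v -> psi' v = psi v &
        forall v t, sphere R d v -> t \in `[0, 1] ->
          h' (v, t) = h (v, Num.min (2 * t) 1)].
Proof.
move=> cf nf dn cpsi cphi ch h0 h1.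
have SD := @sphere_sub_disc R d.
have I1 : (1 : R) \in `[0, 1] by rewrite in_itv /= ler01 lexx.
have [k [ck k0 kh]] := disc_homotopy_extension cphi ch h0.
(* The end of the extended homotopy equals [f \o psi] on the sphere strictly, as compression
   requires. *)
have ck1 : {within disc R d, continuous (fun v => k (v, 1))}.
  apply: (within_comp (f := fun v : 'rV[R]_d => (v, 1 : R)) _ ck); last by [].

  by apply: continuous_subspaceT; continuity_arith.
have [|psi' [cpsi' psiE [G [cG G0 G1 GS]]]] :=
    compression_disc b0 cf nf dn cpsi ck1.
  by move=> v sv; rewrite kh ?h1.
exists psi', (fun p => if 2 * p.2 - 1 <= 0 then k (p.1, 2 * p.2)
                       else G (p.1, 2 * p.2 - 1)); split=> //=.
- by apply: within_concat => // v dv; rewrite G0.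
- move=> v dv; split; first by rewrite ifT ?mulr0 ?k0 //; lra.
  rewrite ifF; last by apply/negbTE; rewrite -ltNge; lra.
  by rewrite (_ : 2 * 1 - 1 = 1) ?G1 //; ring.
- move=> v t sv; rewrite in_itv /= => t01.
  case: ifPn => t2.
    by rewrite min_l ?kh // ?in_itv /=; lra.
  rewrite -ltNge in t2; rewrite min_r; last by lra.
  by rewrite GS // ?kh // in_itv /=; lra.
Qed.

(** * Lifting maps on CW complexes *)

(** The strict bound makes this the usual (d-1)-skeleton: it is empty for d = 0, and it contains the
    boundary of every d-cell. *)
Definition skeleton (R : realType) (K : topologicalType) (W : CW_structure R K)
    (d : nat) : set K :=
  [set x | exists d' (c : cell W d'),
    (d' < d)%N /\ (char_map c @` open_disc R d') x].

(** [lam] and [H] are total functions with arbitrary values off the cells concerned. Testing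
    continuity on closed discs avoids putting a topology on the skeleta and is the form in which the
    weak topology is used at the end. *)
Definition lifts_below (R : realType) (K B Y : topologicalType)
    (W : CW_structure R K) (f : B -> Y) (phi : K -> Y) (d : nat)
    (lam : K -> B) (H : K * R -> Y) : Prop :=
  forall d' (c : cell W d'), (d' < d)%N ->
    [/\ {within disc R d', continuous (fun v => lam (char_map c v))},
        {within disc R d' `*` (`[0, 1] : set R),
          continuous (fun q => H (char_map c q.1, q.2))} &
        forall v, disc R d' v ->
          H (char_map c v, 0) = phi (char_map c v) /\
          H (char_map c v, 1) = f (lam (char_map c v))].

Lemma char_map_within (R : realType) (K : topologicalType)
    (W : CW_structure R K) (d : nat) (c : cell W d) :
  {within disc R d, continuous (char_map c)}.
Proof. exact: char_map_continuous. Qed.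
Arguments char_map_within {R K W d} c _ _ _.

Lemma char_map_sphere (R : realType) (K : topologicalType)
    (W : CW_structure R K) (d : nat) (c : cell W d) (v : 'rV[R]_d) :
  sphere R d v -> skeleton W d (char_map c v).
Proof.
move=> sv; have [F finF [Fd sub]] := closure_finite c.
have [|e Fe [u ou uE]] := sub (char_map c v); first by exists v.
by exists (projT1 e), (projT2 e); split; [exact: Fd | exists u].
Qed.

Lemma disc_open_or_sphere (R : realType) (d : nat) (v : 'rV[R]_d) :
  disc R d v -> open_disc R d v \/ sphere R d v.
Proof. by rewrite /disc /= le_eqVlt => /orP[/eqP|]; [right|left]. Qed.

Lemma char_map_disc (R : realType) (K : topologicalType)
    (W : CW_structure R K) (d d' : nat) (c : cell W d') (v : 'rV[R]_d') :
  (d' < d)%N -> disc R d' v -> skeleton W d (char_map c v).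
Proof.
move=> dd /disc_open_or_sphere[ov|sv]; first by exists d', c; split=> //; exists v.
have [e [ce [lt_e im]]] := char_map_sphere c sv.
by exists e, ce; split=> //; exact: ltn_trans dd.
Qed.

(** By closure-finiteness the attaching map lands in finitely many closed cells of lower dimension.
    These are compact images of discs, so continuity along each characteristic map gives continuity
    on their union. *)
Lemma lifts_below_sphere (R : realType) (K B Y : topologicalType)
    (W : CW_structure R K) (f : B -> Y) (phi : K -> Y) (d : nat)
    (lam : K -> B) (H : K * R -> Y) (c : cell W d) :
  lifts_below W f phi d lam H ->
  {within sphere R d, continuous (fun v => lam (char_map c v))} /\
  {within sphere R d `*` (`[0, 1] : set R),
    continuous (fun q => H (char_map c q.1, q.2))}.
Proof.
move=> low; have [F finF [Fd sub]] := closure_finite c.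
have SD := @sphere_sub_disc R d.
have OD e : open_disc R e `<=` disc R e by move=> v; exact: ltW.
have cS : {within sphere R d, continuous (char_map c)}.
  exact: (continuous_subspaceW SD (char_map_within c)).
have hK := CW_hausdorff W.
split.
  apply: (within_comp (E := \bigcup_(e in F)
    (char_map (projT2 e) @` disc R (projT1 e))) cS); last first.
    move=> v sv; have [|e Fe [u ou uE]] := sub (char_map c v); first by exists v.
    by exists e => //; exists u => //; exact: OD.
  apply: (@within_finite_cover _ F (fun e => 'rV[R]_(projT1 e))
    (fun e => disc R (projT1 e)) _ _ (fun e => char_map (projT2 e))) => //.
  - by move=> e _; exact: disc_compact.
  - by move=> e _; exact: char_map_within.
  - by move=> e /Fd Fe; have [] := low _ (projT2 e) Fe.
have cSI : {within sphere R d `*` (`[0, 1] : set R),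
    continuous (fun q : 'rV[R]_d * R => (char_map c q.1, q.2))}.
  apply: within_pair; last by apply: continuous_subspaceT; continuity_arith.
  apply: (within_comp (f := fst) _ cS); last by move=> q [].
  by apply: continuous_subspaceT; continuity_arith.
apply: (within_comp (E := \bigcup_(e in F)
  ((fun q : 'rV[R]_(projT1 e) * R => (char_map (projT2 e) q.1, q.2)) @`
    (disc R (projT1 e) `*` (`[0, 1] : set R)))) cSI); last first.
  move=> [v t] [/= sv It].
  have [|e Fe [u ou uE]] := sub (char_map c v); first by exists v.
  by exists e => //; exists (u, t) => /=; [split=> //; exact: OD | rewrite uE].
apply: (@within_finite_cover _ F (fun e => 'rV[R]_(projT1 e) * R)%type
  (fun e => disc R (projT1 e) `*` (`[0, 1] : set R)) _ _
  (fun e q => (char_map (projT2 e) q.1, q.2))) => //.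
- by apply: hausdorff_prod => //; exact: Rhausdorff.
- move=> e _; apply: compact_setX; [exact: disc_compact | exact: segment_compact].
- move=> e _; apply: within_pair; last by apply: continuous_subspaceT; continuity_arith.
  apply: (within_comp (f := fst) _ (char_map_within (projT2 e))).
    by apply: continuous_subspaceT; continuity_arith.
  by move=> q [].
- by move=> e /Fd Fe; have [] := low _ (projT2 e) Fe.
Qed.

Lemma cell_unique (R : realType) (K : topologicalType) (W : CW_structure R K)
    (d : nat) (c c' : cell W d) (v v' : 'rV[R]_d) :
  open_disc R d v -> open_disc R d v' -> char_map c v = char_map c' v' ->
  c = c' /\ v = v'.
Proof.
move=> ov ov' E.
have /cells_disjoint cc : (char_map c @` open_disc R d) `&`
    (char_map c' @` open_disc R d) !=set0.
  by exists (char_map c v); split; [exists v | exists v'].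
have {}cc : c = c'.
  exact: (Eqdep_dec.inj_pair2_eq_dec _ PeanoNat.Nat.eq_dec _ _ _ _ cc).
by subst c'; split=> //; apply: (char_map_inj (c := W) (e := c)); rewrite ?inE.
Qed.

Lemma cell_not_skeleton (R : realType) (K : topologicalType)
    (W : CW_structure R K) (d : nat) (c : cell W d) (v : 'rV[R]_d) :
  open_disc R d v -> ~ skeleton W d (char_map c v).
Proof.
move=> ov [d' [c' [dd [v' ov' E]]]].
have /cells_disjoint cc : (char_map c' @` open_disc R d') `&`
    (char_map c @` open_disc R d) !=set0.
  by exists (char_map c v); split; [exists v' | exists v].
have dE : d' = d := congr1 (@projT1 _ _) cc.
by rewrite dE ltnn in dd.
Qed.

Lemma continuous_min_double (R : realType) :
  continuous (fun t : R => Num.min (2 * t) 1).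
Proof.
have -> : (fun t : R => Num.min (2 * t) 1) =
    (fun t => if 2 * t - 1 <= 0 then 2 * t else 1).
  by apply/funext => t; rewrite minEle subr_le0.
apply/continuous_subspace_setT; apply: within_ite.
- by apply: continuous_subspaceT; continuity_arith.
- by apply: continuous_subspaceT; continuity_arith.
- by apply: continuous_subspaceT; continuity_arith.
- by move=> t _ ?; lra.
Qed.

(** Each d-cell is treated separately by [relative_lifting], and the choices are then assembled. The
    old homotopy is reparametrized by [Num.min (2 * t) 1] on the lower cells because this is its
    form on the boundary of each new cell. *)
Lemma lifts_below_step (R : realType) (n d : nat) (K B Y : topologicalType)
    (W : CW_structure R K) (f : B -> Y) (b0 : B) (phi : K -> Y)
    (lam : K -> B) (H : K * R -> Y) :
  continuous f -> n_equivalence R n f -> (d <= n)%N -> continuous phi ->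
  lifts_below W f phi d lam H ->
  exists lam' H', lifts_below W f phi d.+1 lam' H'.
Proof.
move=> cf nf dn cphi low.
have SD := @sphere_sub_disc R d.
have ext (c : cell W d) : exists p : ('rV[R]_d -> B) * ('rV[R]_d * R -> Y),
    [/\ {within disc R d, continuous p.1},
        {within disc R d `*` (`[0, 1] : set R), continuous p.2},
        forall v, disc R d v -> p.2 (v, 0) = phi (char_map c v) /\
                                p.2 (v, 1) = f (p.1 v),
        forall v, sphere R d v -> p.1 v = lam (char_map c v) &
        forall v t, sphere R d v -> t \in `[0, 1] ->
          p.2 (v, t) = H (char_map c v, Num.min (2 * t) 1)].
  have [clam cH] := lifts_below_sphere c low.
  have bd v : sphere R d v ->
      H (char_map c v, 0) = phi (char_map c v) /\
      H (char_map c v, 1) = f (lam (char_map c v)).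
    move=> /(char_map_sphere c)[d' [c' [dd [v' ov' <-]]]].
    by have [_ _] := low _ c' dd; apply; exact: ltW.
  have [|||psi' [h' [p1 p2 p3 p4 p5]]] := relative_lifting b0 cf nf dn clam
      (phi := fun v => phi (char_map c v)) _ cH.
  - apply: (within_comp (E := setT) (char_map_within c)) => //.
    exact: continuous_subspaceT.
  - by move=> v /bd[].
  - by move=> v /bd[].
  by exists (psi', h').
have {ext}[F FP] := choice ext.
(* The values at a point are specified by both clauses, but a point of an open d-cell is not in
   [skeleton W d] and determines its cell and coordinate, so the clauses never conflict. On cells of
   higher dimension the value is a mere placeholder. *)
have glue (x : K) : exists p : B * (R -> Y),
    (skeleton W d x -> p.1 = lam x /\ forall t, p.2 t = H (x, Num.min (2 * t) 1)) /\
    (forall (c : cell W d) v, open_disc R d v -> char_map c v = x ->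
       p.1 = (F c).1 v /\ forall t, p.2 t = (F c).2 (v, t)).
  have [sx|nsx] := pselect (skeleton W d x).
    exists (lam x, fun t => H (x, Num.min (2 * t) 1)); split=> // c v ov vx.
    by exfalso; apply: (cell_not_skeleton (c := c) ov); rewrite vx.
  have [[c [v ov vx]]|no] :=
    pselect (exists c : cell W d, exists2 v, open_disc R d v & char_map c v = x).
    exists ((F c).1 v, fun t => (F c).2 (v, t)); split=> // c' v' ov' vx'.
    by have [|-> ->] := cell_unique ov ov' (c := c) (c' := c'); first by rewrite vx'.
  exists (lam x, fun t => H (x, t)); split=> // c v ov vx.
  by exfalso; apply: no; exists c, v.
have {glue}[G GP] := choice glue.
exists (fun x => (G x).1), (fun q => (G q.1).2 q.2) => d' c.
rewrite ltnS leq_eqVlt => /predU1P[dE|dd].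
  subst d'.
  (* On the sphere [G] comes from the lower cells and not from [F c]; the boundary conditions on
     [F c] show that the two agree for times in [0, 1]. *)
  have Gc v : disc R d v -> (G (char_map c v)).1 = (F c).1 v /\
      forall t, t \in `[0, 1] -> (G (char_map c v)).2 t = (F c).2 (v, t).
    have [_ _ _ F4 F5] := FP c.
    move=> /disc_open_or_sphere[ov|sv].
      by have [_ /(_ c v ov erefl)[-> Gt]] := GP (char_map c v); split.
    have [/(_ (char_map_sphere c sv))[-> Gt] _] := GP (char_map c v).
    by split=> [|t It]; rewrite ?Gt ?F4 ?F5.
  have [F1 F2 F3 _ _] := FP c; split.
  - by apply: within_ext F1 => v dv; have [->] := Gc v dv.
  - by apply: within_ext F2 => -[v t] [/= dv It]; have [_ ->] := Gc v dv.
  - move=> v dv /=; have [-> Gt] := Gc v dv; rewrite !Gt ?in_itv /= ?ler01 ?lexx //.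
    exact: F3.
have Gc v : disc R d' v -> (G (char_map c v)).1 = lam (char_map c v) /\
    forall t, (G (char_map c v)).2 t = H (char_map c v, Num.min (2 * t) 1).
  move=> dv; have [h _] := GP (char_map c v); apply: h; exact: char_map_disc.
have [l1 l2 l3] := low _ c dd; split.
- by apply: within_ext l1 => v dv; have [->] := Gc v dv.
- apply: (within_ext (f := fun q : 'rV[R]_d' * R =>
    H (char_map c q.1, Num.min (2 * q.2) 1))).
    by move=> [v t] [/= dv It]; have [_ ->] := Gc v dv.
  apply: (within_comp (f := fun q : 'rV[R]_d' * R => (q.1, Num.min (2 * q.2) 1)) _ l2).
    apply: continuous_subspaceT; apply: continuous_pair; first by continuity_arith.
    apply: (continuous_then (f := snd) _ (@continuous_min_double R)).
    by continuity_arith.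
  move=> [v t] [/= dv]; rewrite in_itv /= => t01; split=> //=.
  by rewrite in_itv /= le_min ge_min lexx ler01 orbT !andbT; lra.
- move=> v dv /=; have [-> Gt] := Gc v dv; rewrite !Gt mulr0 mulr1.
  rewrite min_l ?ler01 // min_r; last by lra.
  exact: l3.
Qed.

(** * From continuity on cells to continuity on the complex *)

Lemma CW_continuous (R : realType) (K Z : topologicalType)
    (W : CW_structure R K) (g : K -> Z) :
  (forall d (c : cell W d), {within disc R d, continuous (fun v => g (char_map c v))}) ->
  continuous g.
Proof.
move=> cg; apply/continuous_closedP => V clV; apply: (weak_topology (c := W)) => d c.
have -> : g @^-1` V `&` char_map c @` disc R d =
    char_map c @` (disc R d `&` (fun v => g (char_map c v)) @^-1` V).
  apply/seteqP; split=> [x [gV [v dv vx]]|_ [v [dv gV] <-]].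
    by exists v => //; split=> //=; rewrite vx.
  by split=> //; exists v.
apply: closed_image_preimage => //; [exact: CW_hausdorff W | exact: disc_compact |].
exact: char_map_within.
Qed.

(* A tube argument: since the interval is compact, K x [0, 1] carries the
   topology determined by the cells of K times [0, 1]. *)
Lemma CW_homotopy_continuous (R : realType) (K Z : topologicalType)
    (W : CW_structure R K) (H : K * R -> Z) :
  (forall d (c : cell W d), {within disc R d `*` (`[0, 1] : set R),
     continuous (fun q => H (char_map c q.1, q.2))}) ->
  {within [set: K] `*` `[0, 1], continuous H}.
Proof.
move=> cH; apply/subspace_continuousP => -[x t] [_ /= It] V.
rewrite /from_subspace nbhsE => -[U [oU Ux] UV].
have [d [c [v ov vx]]] := cells_cover W x.
have dv : disc R d v by exact: ltW.
have cHx : {within `[0, 1], continuous (fun s : R => H (x, s))}.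
  rewrite -vx; apply: (within_comp (f := fun s : R => (v, s)) _ (cH d c)).
    by apply: continuous_subspaceT; continuity_arith.
  by [].
have : nbhs t [set s | s \in `[0, 1] -> U (H (x, s))].
  move/subspace_continuousP: cHx => /(_ t It); apply.
  by apply: open_nbhs_nbhs; split.
move=> /nbhs_closedballP[e Ne].
pose N : set R := `[0, 1] `&` closed_ball t e%:num.
have cN : compact N.
  by apply: compact_closedI; [exact: segment_compact | exact: closed_ball_closed].
(* The points whose track leaves [U] at some time in [N]. On a closed cell this is the projection of
   a compact set, so [C] is closed in the weak topology; it avoids [x], and its complement times the
   ball is the required tube. *)
pose C : set K := [set y | exists2 s, N s & ~ U (H (y, s))].
have clC : closed C.
  apply: (weak_topology (c := W)) => d' c'.
  have -> : C `&` char_map c' @` disc R d' =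
      (fun q : 'rV[R]_d' * R => char_map c' q.1) @`
      ((disc R d' `*` N) `&` (fun q => H (char_map c' q.1, q.2)) @^-1` (~` U)).
    apply/seteqP; split=> [x' [[s Ns nU] [u du ux]]|_ [[u s] [[/= du Ns] nU] <-]].
      by exists (u, s) => //; split=> //=; rewrite ux.
    by split; [exists s | exists u].
  apply: closed_image_preimage.
  - exact: CW_hausdorff W.
  - by apply: compact_setX => //; exact: disc_compact.
  - apply: (within_comp (f := fst) _ (char_map_within c')); last by move=> q [].
    by apply: continuous_subspaceT; continuity_arith.
  - by apply: continuous_subspaceW (cH d' c') => -[u s] [/= du [Is _]].
  - exact: open_closedC.
exists (~` C, ball t e%:num).
  split; last exact: nbhsx_ballx.
  apply: open_nbhs_nbhs; split; first exact: closed_openC.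
  by move=> [s [Is Bs]]; apply; exact: Ne.
move=> [y s] /= [nC Bs] [_ Is]; apply: UV; apply: contrapT => nU; apply: nC.
by exists s => //; split=> //; exact: subset_closed_ball.
Qed.

Lemma CW_lifting (R : realType) (n : nat) (K B Y : topologicalType) (f : B -> Y)
    (b0 : B) (phi : K -> Y) :
  CW_complex_dim_le R n K -> continuous f -> n_equivalence R n f ->
  continuous phi ->
  exists2 lam : K -> B, continuous lam & homotopic R phi (f \o lam).
Proof.
move=> [W Wn] cf nf cphi.
(* At d = 0 the condition is vacuous, so any functions will do. The bound n + 1 is reached because
   the step from d to d + 1 requires d <= n, and by the dimension bound all cells are then
   covered. *)
have low d : (d <= n.+1)%N -> exists lam H, lifts_below W f phi d lam H.
  elim: d => [|d IHd] dn; first by exists (cst b0), (fun q => phi q.1).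
  have [|lam [H low]] := IHd; first exact: ltnW.
  exact: (lifts_below_step b0 cf nf dn cphi low).
have [lam [H lamH]] := low _ (leqnn _).
have {}lamH d (c : cell W d) := lamH d c.
have dimW d (c : cell W d) : (d < n.+1)%N.
  by rewrite ltnS leqNgt; apply/negP => /Wn; apply.
exists lam.
  by apply: (CW_continuous (W := W)) => d c; have [] := lamH d c (dimW d c).
exists H; split=> //.
- by apply: (CW_homotopy_continuous (W := W)) => d c; have [] := lamH d c (dimW d c).
- move=> x _; have [d [c [v ov <-]]] := cells_cover W x.
  by have [_ _ h] := lamH d c (dimW d c); have [|] := h v; first exact: ltW.
- move=> x _; have [d [c [v ov <-]]] := cells_cover W x.
  by have [_ _ h] := lamH d c (dimW d c); have [|] := h v; first exact: ltW.
Qed.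

(** * Transfer of categorical covers *)

Lemma categorical_cover_skeleton (R : realType) (n k : nat)
    (X X' A B : ptopologicalType) (i : A -> X) (j : B -> X') :
  homotopy_equivalent R X X' -> n_skeleton R n i -> n_skeleton R n j ->
  categorical_cover R i k -> categorical_cover R j k.
Proof.
move=> [e [g [ce cg _ eg]]] [ci _ _ _ ni] [cj _ _ [K [dK [p [q [cp cq qp _]]]]] _].
move=> [U [oU coverU conU]].
(* Lifting requires a complex that is itself of dimension at most n, so it is applied on K to
   [g \o j \o q]; precomposing with [p] returns to B, where [q \o p] is homotopic to the
   identity. *)
have [lam clam lamP] := CW_lifting point dK ci ni
  (continuous_then cq (continuous_then cj cg)).
have cl : continuous (lam \o p) by exact: (continuous_then cp clam).
have hl : homotopic R (i \o (lam \o p)) (g \o j).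
  apply: (homotopic_rel_trans (g := (g \o j) \o (q \o p))) => //.
    apply: homotopic_rel_sym => //.
    apply: (homotopic_rel_precomp (h := p) _ _ _ lamP) => //.
    exact: continuous_subspaceT.
  exact: (homotopic_rel_postcomp (continuous_then cj cg) qp).
(* Returning to X' by [e] shows that [j] factors through [i] up to homotopy, so a null-homotopy of
   [i] on [U l] gives one of [j] on the preimage, with constant value [e c]. *)
have hj : homotopic R j (e \o (i \o (lam \o p))).
  apply: (homotopic_rel_trans (g := (e \o g) \o j)) => //.
    apply: homotopic_rel_sym => //.
    apply: (homotopic_rel_precomp (h := j) _ _ _ eg) => //.
    exact: continuous_subspaceT.
  apply: homotopic_rel_sym => //.
  exact: homotopic_rel_postcomp hl.
exists (fun l => (lam \o p) @^-1` U l); split.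
- by move=> l; apply: open_comp (oU l) => x _; exact: cl.
- by rewrite -preimage_bigcup coverU preimage_setT.
- move=> l; have [c hc] := conU l; exists (e c).
  apply: (homotopic_rel_trans (g := e \o (i \o (lam \o p)))) => //.
    apply: (homotopic_rel_precomp (h := id) _ _ _ hj) => //.
    apply: continuous_subspaceT; exact: continuous_idfun.
  apply: (homotopic_rel_postcomp ce).
  apply: (homotopic_rel_precomp (h := lam \o p) _ _ _ hc) => //.
  exact: continuous_subspaceT.
Qed.

Lemma homotopy_equivalent_sym (R : realType) (X Y : topologicalType) :
  homotopy_equivalent R X Y -> homotopy_equivalent R Y X.
Proof. by move=> [f [g [cf cg gf fg]]]; exists g, f. Qed.

Theorem proposition2p1 (R : realType) (n : nat) (X X' A B : ptopologicalType)
    (i : A -> X) (j : B -> X') :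
  homotopy_equivalent R X X' ->
  n_skeleton R n i ->
  n_skeleton R n j ->
  LS_cat R i = LS_cat R j.
Proof.
move=> XX' si sj.
(* [LS_cat] depends on the map only through this predicate of k, so equality of the predicates
   settles the finite and the infinite case together. *)
have E : categorical_cover R i = categorical_cover R j.
  apply/funext => k; apply/propext; split.
    exact: categorical_cover_skeleton XX' si sj.
  exact: categorical_cover_skeleton (homotopy_equivalent_sym XX') sj si.
by rewrite /LS_cat E.
Qed.
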